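(* Let $R$ be a unital Banach algebra with norm $\|\cdot\|$ and identity $I$. Let $A,B,Z\in R$ be (in general noncommuting) parameters and let $Q\in R$ be the base. Suppose that $Q$ and $A$ both commute with each of the other parameters (while $B$ and $Z$ need not commute with each other). Assume that $\|Z\|<1$ and $\|BZ^{-1}A^{-1}\|<1$. Then the following two summations hold. (Type I) $$ {}_1\psi_1\!\left\lceil\!\begin{array}{c}A\\ B\end{array}\!;Q,Z\right\rfloor= Z^{-1}\left\lfloor\!\begin{array}{c}Q,\;ZBZ^{-1}A^{-1}\\ A^{-1}Q,\;Z\end{array}\!;Q,I\right\rceil_\infty \left\lceil\!\begin{array}{c}AZ\\ ZBZ^{-1}\end{array}\!;Q,I\right\rfloor_\infty \left\lfloor\!\begin{array}{c}Z^{-1}A^{-1}Q\\ BZ^{-1}A^{-1}\end{array}\!;Q,I\right\rceil_\infty Z . $$ (Type II) $$ {}_1\psi_1\!\left\lfloor\!\begin{array}{c}A\\ B\end{array}\!;Q,Z\right\rceil= Z^{-1}\;{}^{\sim}\!\left\lfloor\!\begin{array}{c}Z^{-1}A^{-1}Q\\ BZ^{-1}A^{-1}\end{array}\!;Q,I\right\rceil_\infty \left\lfloor\!\begin{array}{c}AZ,\;Q\\ A^{-1}Q,\;B\end{array}\!;Q,I\right\rceil_\infty {}^{\sim}\!\left\lfloor\!\begin{array}{c}A^{-1}B\\ Z\end{array}\!;Q,I\right\rceil_\infty Z . $$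
   Context: $R$ is a unital Banach algebra with norm $\|\cdot\|$, identity $I$ and zero $O$; its elements do not commute in general. The base $Q\in R$ commutes with all other parameters that appear (for instance $Q=qI$, $q$ a scalar), and $\|Q\|<1$. All expressions that appear are implicitly assumed to be well defined; in particular, whenever an inverse $X^{-1}$ is written (also inside the definitions below, including the products with negative index and the negative powers of $Q$ in them), its existence is assumed. Ordered products. For integers $l,m$, $$\prod_{j=l}^m X_j=\begin{cases} I & m=l-1,\\ X_lX_{l+1}\cdots X_m & m\ge l,\\ X_{l-1}^{-1}X_{l-2}^{-1}\cdots X_{m+1}^{-1} & m<l-1.\end{cases}$$ Products $\prod_{i=1}^r$ are ordered in the same way, with $i$ increasing from left to right. Noncommutative $Q$-shifted factorials. For an integer $k$ (possibly negative): type I: $$\left\lceil\!\begin{array}{c}A_1,\dots,A_r\\ B_1,\dots,B_r\end{array}\!;Q,Z\right\rfloor_k=\prod_{j=1}^k\left[\left(\prod_{i=1}^r(I-B_iQ^{k-j})^{-1}(I-A_iQ^{k-j})\right)Z\right];$$ type II: $$\left\lfloor\!\begin{array}{c}A_1,\dots,A_r\\ B_1,\dots,B_r\end{array}\!;Q,Z\right\rceil_k=\prod_{j=1}^k\left[\left(\prod_{i=1}^r(I-B_iQ^{j-1})^{-1}(I-A_iQ^{j-1})\right)Z\right];$$ reversed type II: $${}^{\sim}\!\left\lfloor\!\begin{array}{c}A_1,\dots,A_r\\ B_1,\dots,B_r\end{array}\!;Q,Z\right\rceil_k=\prod_{j=1}^k\left(Z\prod_{i=1}^r(I-A_iQ^{k-j})(I-B_iQ^{k-j})^{-1}\right).$$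 For $k=\infty$ these denote the limits in $R$ as $k\to\infty$ of the corresponding expressions. Noncommutative bilateral basic hypergeometric series of type I and type II: $${}_1\psi_1\!\left\lceil\!\begin{array}{c}A\\ B\end{array}\!;Q,Z\right\rfloor=\sum_{k=-\infty}^{\infty}\left\lceil\!\begin{array}{c}A\\ B\end{array}\!;Q,Z\right\rfloor_k,\qquad {}_1\psi_1\!\left\lfloor\!\begin{array}{c}A\\ B\end{array}\!;Q,Z\right\rceil=\sum_{k=-\infty}^{\infty}\left\lfloor\!\begin{array}{c}A\\ B\end{array}\!;Q,Z\right\rceil_k .$$ *)

(* Defs.v *)
From HB Require Import structures.
From mathcomp Require Import all_boot all_order all_algebra.
From mathcomp Require Import all_classical all_reals all_analysis.

Set Implicit Arguments.
Unset Strict Implicit.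
Unset Printing Implicit Defensive.

Import Order.TTheory GRing.Theory Num.Theory.
Import numFieldNormedType.Exports.

Local Open Scope classical_set_scope.
Local Open Scope ring_scope.

(* A unital Banach algebra over K.  The normalization `|1| = 1 is not required,
   so that both usual conventions are covered.  A complex Banach algebra is in
   particular a real one, by restriction of scalars.

   MathComp's hierarchy does not allow a structure joining rings and normed
   modules below numDomainType, hence a record on top of completeNormedModType
   whose carrier is then equipped with both kinds of instances. *)
Record banachAlgType (K : numFieldType) := BanachAlg {
  banach_base : completeNormedModType K;
  banach_one : banach_base;
  banach_mul : banach_base -> banach_base -> banach_base;
  banach_mulA : associative banach_mul;
  banach_mul1x : left_id banach_one banach_mul;
  banach_mulx1 : right_id banach_one banach_mul;
  banach_mulDl : left_distributive banach_mul +%R;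
  banach_mulDr : right_distributive banach_mul +%R;
  banach_scaleAl : forall (a : K) x y,
    a *: banach_mul x y = banach_mul (a *: x) y;
  banach_scaleAr : forall (a : K) x y,
    a *: banach_mul x y = banach_mul x (a *: y);
  banach_one_neq0 : banach_one != 0;
  banach_normM : forall x y, `|banach_mul x y| <= `|x| * `|y|
}.

Definition banach_sort (K : numFieldType) (V : banachAlgType K) : Type :=
  banach_base V.
Coercion banach_sort : banachAlgType >-> Sortclass.

Section BanachInstances.
Context (K : numFieldType) (V : banachAlgType K).

HB.instance Definition _ := CompleteNormedModule.copy V (banach_base V).

HB.instance Definition _ := GRing.Zmodule_isNzRing.Build V
  (@banach_mulA K V) (@banach_mul1x K V) (@banach_mulx1 K V)
  (@banach_mulDl K V) (@banach_mulDr K V) (@banach_one_neq0 K V).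

HB.instance Definition _ :=
  GRing.Lmodule_isLalgebra.Build K V (@banach_scaleAl K V).

HB.instance Definition _ :=
  GRing.Lalgebra_isAlgebra.Build K V (@banach_scaleAr K V).

Definition banach_unit : pred V :=
  fun x => `[< exists y : V, y * x = 1 /\ x * y = 1 >].

(* The two-sided inverse of x if there is one, and x otherwise, following the
   convention of unitRingType. *)
Definition banach_inv (x : V) : V := xget x [set y | y * x = 1 /\ x * y = 1].

Let banach_invP x : banach_unit x ->
  banach_inv x * x = 1 /\ x * banach_inv x = 1.
Proof.
move=> /asboolP ux.
exact: (xgetPex x (P := [set y : V | y * x = 1 /\ x * y = 1]) ux).
Qed.

Let banach_mulVr : {in banach_unit, left_inverse 1 banach_inv *%R}.
Proof. by move=> x /banach_invP[]. Qed.

Let banach_divrr : {in banach_unit, right_inverse 1 banach_inv *%R}.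
Proof. by move=> x /banach_invP[]. Qed.

Let banach_unitrP (x y : V) : y * x = 1 /\ x * y = 1 -> banach_unit x.
Proof. by move=> xy; apply/asboolP; exists y. Qed.

Let banach_invr_out : {in [predC banach_unit], banach_inv =1 id}.
Proof.
move=> x /negP ux; rewrite /banach_inv xgetPN// => y xy.
by apply: ux; apply: banach_unitrP xy.
Qed.

HB.instance Definition _ := GRing.NzRing_hasMulInverse.Build V
  banach_mulVr banach_divrr banach_unitrP banach_invr_out.

Lemma ler_normM_banach (x y : V) : `|x * y| <= `|x| * `|y|.
Proof. exact: banach_normM. Qed.

End BanachInstances.

Section Definitions.
Context {K : numFieldType} {V : banachAlgType K}.
Implicit Types (Q Z : V) (k l m : int).

(* X_l X_(l+1) ... X_m if l <= m, 1 if m = l - 1, and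
   X_(l-1)^-1 X_(l-2)^-1 ... X_(m+1)^-1 if m < l - 1.  In the last case
   Negz n = - (n + 1) with n + 1 = l - 1 - m the number of factors. *)
Definition oprod l m (X : int -> V) : V :=
  match m - l + 1 with
  | Posz n => \prod_(0 <= i < n) X (l + i%:Z)
  | Negz n => \prod_(0 <= i < n.+1) (X (l - 1 - i%:Z))^-1
  end.

Definition qfactor r (A B : r.-tuple V) Q k : V :=
  \prod_(i < r) ((1 - tnth B i * Q ^ k)^-1 * (1 - tnth A i * Q ^ k)).

Definition qfactor_rev r (A B : r.-tuple V) Q k : V :=
  \prod_(i < r) ((1 - tnth A i * Q ^ k) * (1 - tnth B i * Q ^ k)^-1).

Definition qfactI r (A B : r.-tuple V) Q Z k : V :=
  oprod 1 k (fun j => qfactor A B Q (k - j) * Z).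

Definition qfactII r (A B : r.-tuple V) Q Z k : V :=
  oprod 1 k (fun j => qfactor A B Q (j - 1) * Z).

Definition qfactII_rev r (A B : r.-tuple V) Q Z k : V :=
  oprod 1 k (fun j => Z * qfactor_rev A B Q (k - j)).

(* Limit as k -> +oo; meaningful only together with [cvg_infty f]. *)
Definition at_infty (f : int -> V) : V := limn (fun n : nat => f n%:Z).

Definition cvg_infty (f : int -> V) : Prop := cvgn (fun n : nat => f n%:Z).

(* A bilateral series converges when its two halves do. *)
Definition bilateral_cvg (f : int -> V) : Prop :=
  cvgn (series (fun n : nat => f n%:Z)) /\
  cvgn (series (fun n : nat => f (- n.+1%:Z))).

Definition bilateral_sum (f : int -> V) : V :=
  limn (series (fun n : nat => f n%:Z)) +
  limn (series (fun n : nat => f (- n.+1%:Z))).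

Definition psi11_I (A B Q Z : V) : V :=
  bilateral_sum (qfactI [tuple A] [tuple B] Q Z).

Definition psi11_II (A B Q Z : V) : V :=
  bilateral_sum (qfactII [tuple A] [tuple B] Q Z).

End Definitions.

(* Main.v *)
Require Import Defs.
From HB Require Import structures.
From mathcomp Require Import all_boot all_order all_algebra.
From mathcomp Require Import all_classical all_reals all_analysis.
From mathcomp Require Import ring lra.
Set Implicit Arguments.
Unset Strict Implicit.
Unset Printing Implicit Defensive.
Import Order.TTheory GRing.Theory Num.Theory.
Import numFieldNormedType.Exports.
Local Open Scope classical_set_scope.
Local Open Scope ring_scope.

(* Put X = AZ and let U_k be the solution of (1 - B Q^k) U_(k+1) = - X Q^k U_k
   with U_0 = 1.  For central b let e_j = 1 / (bQ; Q)_j.  The sums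
   H_n = sum_k e_(n-k) U_k satisfy the first-order recurrence
     (1 - b B Q^n) H_(n+1) = (1 - b X Q^n) H_n,
   and H_n tends to e_oo sum_k U_k by Tannery's theorem.  For b = A^-1, H_0 is
   (up to conjugation) the type I series, which is thereby reduced to
   sum_k U_k.  For b = 1, H_0 is a one-sided series summed by a noncommutative
   q-binomial theorem, and the same recurrence then evaluates sum_k U_k.
   The type II summation is the same statement in the opposite algebra. *)

(** On the proof as a whole: [X] and [B] do not commute, so the products coming from different
    recurrences cannot be merged, and each of the three products of the type I answer records its
    own recurrence. The q-binomial sum at b = 1 gives the rightmost one. Following H_n upwards from
    H_0 at b = 1 gives the middle one. Following H_n back from its limit to H_0 at b = A^-1 gives
    the leftmost one. The two choices of b can be compared because U_k depends on [X] and [B] only: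
    the two limits differ by central factors e_oo, and the sum of U_k occurs only multiplied by e_oo
    for b = 1, so it is never inverted. The norm hypotheses enter as decay rates. The ratio of
    consecutive terms of H_0 at b = A^-1 tends to A^-1 X = Z as k -> +oo, and that of U_k, read
    downwards, tends to X^-1 B as k -> -oo. All bounds have to be uniform in n for Tannery's
    theorem, which is why they are derived from ratio estimates with a geometric error term. *)

(* The product of the [s + C r^i] is at most [s^k] times a convergent product. *)
Lemma growth_bound (R : realType) (r C s : R) (v : nat -> R) :
  0 <= r < 1 -> 0 <= C -> 0 < s -> (forall k, 0 <= v k) ->
  (forall k, v k.+1 <= (s + C * r ^+ k) * v k) ->
  forall k, v k <= v 0%N * expR (C / s / (1 - r)) * s ^+ k.
Proof.
move=> /andP[r0 r1] C0 s0 v0 vS k.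
have key : v k <= v 0%N * expR (C / s * \sum_(i < k) r ^+ i) * s ^+ k.
  elim: k => [|k IH]; first by rewrite big_ord0 mulr0 expR0 !mulr1.
  apply: le_trans (vS k) _.
  have -> : s + C * r ^+ k = s * (1 + C / s * r ^+ k).
    by field; rewrite gt_eqF.
  rewrite big_ord_recr/= [C / s * (_ + _)]mulrDr expRD exprS.
  have e1 := expR_ge1Dx (C / s * r ^+ k).
  have e2 : 0 <= 1 + C / s * r ^+ k.
    by rewrite addr_ge0// !mulr_ge0 ?invr_ge0 ?exprn_ge0// ltW.
  rewrite -mulrA; have -> : v 0%N * (expR (C / s * \sum_(i < k) r ^+ i) *
      expR (C / s * r ^+ k)) * (s * s ^+ k) = s * (expR (C / s * r ^+ k) *
      (v 0%N * expR (C / s * \sum_(i < k) r ^+ i) * s ^+ k)) by ring.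
  by rewrite ler_wpM2l ?(ltW s0)// ler_pM.
apply: le_trans key _; rewrite ler_wpM2r ?exprn_ge0 ?(ltW s0)//.
rewrite ler_wpM2l// ler_expR ler_wpM2l ?divr_ge0 ?(ltW s0)//.
have r1' : 0 < 1 - r by rewrite subr_gt0.
rewrite -(@ler_pM2l _ (1 - r))// mulfV ?gt_eqF//.
have -> : (1 - r) * \sum_(i < k) r ^+ i = 1 - r ^+ k.
  by apply: oppr_inj; rewrite -mulNr !opprB -subrX1.
by rewrite gerBl exprn_ge0.
Qed.

(** * Limits of products and geometrically dominated series *)

Lemma cvg_mul_banach (R : realType) (V : banachAlgType R) (f g : nat -> V)
    (a b : V) :
  f @ \oo --> a -> g @ \oo --> b -> (fun n => f n * g n) @ \oo --> a * b.
Proof.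
move=> fa gb; apply/subr_cvg0; apply: norm_cvg0.
have fa0 : `|f n - a| @[n --> \oo] --> (0 : R).
  by apply/norm_cvg0P/subr_cvg0.
have gb0 : `|g n - b| @[n --> \oo] --> (0 : R).
  by apply/norm_cvg0P/subr_cvg0.
apply: (@squeeze_cvgr _ _ _ _ (cst 0)
  (fun n => `|f n - a| * `|g n| + `|a| * `|g n - b|)); last 2 first.
- exact: cvg_cst.
- rewrite -[X in _ --> X](addr0 (0 : R)); apply: cvgD.
    rewrite -(mul0r `|b|); apply: cvgM fa0 _; exact: cvg_norm.
  rewrite -(mulr0 `|a|); apply: cvgM _ gb0; exact: cvg_cst.
apply: nearW => n; rewrite normr_ge0/=.
have -> : f n * g n - a * b = (f n - a) * g n + a * (g n - b).
  by rewrite mulrBl mulrBr addrA subrK.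
by apply: le_trans (ler_normD _ _) _; rewrite lerD// ler_normM_banach.
Qed.

Lemma cvgn_geom (R : realType) (V : completeNormedModType R) (f : nat -> V)
    (K s : R) : 0 <= s < 1 -> (forall k, `|f k| <= K * s ^+ k) ->
  cvgn (series f).
Proof.
move=> /andP[s0 s1] fK; apply: normed_cvg.
apply: (@series_le_cvg _ _ (geometric K s)) => //.
- by move=> n /=; exact: normr_ge0.
- by move=> n /=; exact: le_trans (normr_ge0 _) (fK n).
- by apply: is_cvg_geometric_series; rewrite ger0_norm.
Qed.

Lemma series_tail_le (R : realType) (V : completeNormedModType R)
    (f : nat -> V) (K s : R) : 0 <= s < 1 ->
  (forall k, `|f k| <= K * s ^+ k) ->
  forall N, `|limn (series f)| <= `|series f N| + K * s ^+ N / (1 - s).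
Proof.
move=> s01 fK N; have /andP[s0 s1] := s01.
have cf := cvgn_geom s01 fK.
have K0 : 0 <= K by have := fK 0%N; rewrite expr0 mulr1; exact: le_trans (normr_ge0 _).
have s1' : 0 < 1 - s by rewrite subr_gt0.
rewrite -lim_norm//; apply: limr_le; first exact: is_cvg_norm.
exists N => // M /= NM; rewrite -(subnKC NM).
have -> : series f (N + (M - N))%N =
    series f N + \sum_(N <= i < N + (M - N)) f i.
  by rewrite /series/= -big_cat_nat//= leq_addr.
apply: le_trans (ler_normD _ _) _; rewrite lerD2l.
apply: le_trans (ler_norm_sum _ _ _) _.
apply: (@le_trans _ _ (\sum_(N <= i < N + (M - N)) K * s ^+ i)).
  exact: ler_sum.
rewrite -mulr_sumr -mulrA ler_wpM2l// geometric_partial_tail.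
rewrite geometric_seriesE ?lt_eqF//= ler_wpM2r ?invr_ge0 ?(ltW s1')//.
by rewrite ler_piMr ?exprn_ge0// gerBl exprn_ge0.
Qed.

(** The geometric domination makes the tails beyond a fixed [N] small uniformly in [n]; what remains
    is a finite sum, which converges term by term. *)
Lemma tannery (R : realType) (V : completeNormedModType R)
    (f : nat -> nat -> V) (g : nat -> V) (K s : R) : 0 <= s < 1 ->
  (forall n k, `|f n k| <= K * s ^+ k) ->
  (forall k, f ^~ k @ \oo --> g k) ->
  (fun n => limn (series (f n))) @ \oo --> limn (series g).
Proof.
move=> s01 fK fg; have /andP[s0 s1] := s01.
have gK k : `|g k| <= K * s ^+ k.
  have cg : `|f x k| @[x --> \oo] --> `|g k| by exact: cvg_norm.
  rewrite -(cvg_lim _ cg)//; apply: limr_le; first by apply/cvg_ex; exists `|g k|.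
  exact: nearW.
have cf n := cvgn_geom s01 (fK n); have cg := cvgn_geom s01 gK.
have dK n k : `|f n k - g k| <= (K + K) * s ^+ k.
  by rewrite mulrDl; apply: le_trans (ler_normB _ _) _; rewrite lerD.
have limd n : limn (series (f n)) - limn (series g) =
    limn (series (fun k => f n k - g k)).
  rewrite -limB//; congr (limn _); apply/funext => N /=.
  by rewrite /series/= sumrB.
have s1' : 0 < 1 - s by rewrite subr_gt0.
have tail : (K + K) * s ^+ N / (1 - s) @[N --> \oo] --> (0 : R).
  rewrite -(mul0r (1 - s)^-1); apply: cvgM; last exact: cvg_cst.
  by apply: cvg_geometric; rewrite ger0_norm.
apply/cvgrPdist_le => e e0.
have e2 : 0 < e / 2 by rewrite divr_gt0.
move/cvgrPdist_le : tail => /(_ _ e2)[N _ /(_ N (leqnn N))/=].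
rewrite sub0r normrN => hN.
have dN : (fun n => series (fun k => f n k - g k) N) @ \oo --> (0 : V).
  rewrite /series/=; elim: {hN} N => [|N IH].
    by under eq_fun do rewrite big_geq//; exact: cvg_cst.
  under eq_fun do rewrite big_nat_recr//=.
  rewrite -[X in nbhs X](addr0 (0 : V)); apply: cvgD => //.
  exact/subr_cvg0.
move/cvgrPdist_le : dN => /(_ _ e2); apply: filterS => n /=.
rewrite sub0r normrN distrC limd => hn.
apply: le_trans (series_tail_le s01 (dK n) N) _.
rewrite (splitr e) lerD//; apply: le_trans hN; exact: ler_norm.
Qed.

(** * Bilateral sums: linearity, shift invariance, dominated convergence *)

Section BilateralSums.
Context (R : realType) (V : banachAlgType R).
Implicit Types (f g : int -> V) (a b c : V).

(** A relation, so that existence and value travel together through the linear and shift rules; two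
    evaluations of one series are then compared by [has_bsum_unique]. *)
Definition has_bsum f a := exists a1 a2,
  [/\ series (fun n : nat => f n%:Z) @ \oo --> a1,
      series (fun n : nat => f (- n.+1%:Z)) @ \oo --> a2 & a = a1 + a2].

Lemma has_bsumP f a :
  has_bsum f a <-> bilateral_cvg f /\ bilateral_sum f = a.
Proof.
split=> [[a1 [a2 [f1 f2 ->]]]|[[f1 f2] <-]].
  split; first by split; apply/cvg_ex; [exists a1|exists a2].
  by rewrite /bilateral_sum (cvg_lim _ f1)// (cvg_lim _ f2).
by exists (limn (series (fun n : nat => f n%:Z))),
  (limn (series (fun n : nat => f (- n.+1%:Z)))).
Qed.

Lemma has_bsum_unique f a b : has_bsum f a -> has_bsum f b -> a = b.
Proof. by move=> /has_bsumP[_ <-] /has_bsumP[_ <-]. Qed.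

Lemma has_bsumB f g a b : has_bsum f a -> has_bsum g b ->
  has_bsum (fun k => f k - g k) (a - b).
Proof.
move=> [a1 [a2 [f1 f2 ->]]] [b1 [b2 [g1 g2 ->]]].
have E (u v : nat -> V) : series (fun n => u n - v n) =
    (fun n => series u n - series v n).
  by apply/funext => n; rewrite /series/= sumrB.
exists (a1 - b1), (a2 - b2); rewrite !E.
by split; [exact: cvgB|exact: cvgB|rewrite opprD addrACA].
Qed.

Lemma has_bsumMl c f a : has_bsum f a -> has_bsum (fun k => c * f k) (c * a).
Proof.
move=> [a1 [a2 [f1 f2 ->]]]; exists (c * a1), (c * a2).
have E (u : nat -> V) : series (fun n => c * u n) = (fun n => c * series u n).
  by apply/funext => n; rewrite /series/= mulr_sumr.
by rewrite !E mulrDr; split=> //; apply: cvg_mul_banach => //; exact: cvg_cst.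
Qed.

Lemma has_bsumMr c f a : has_bsum f a -> has_bsum (fun k => f k * c) (a * c).
Proof.
move=> [a1 [a2 [f1 f2 ->]]]; exists (a1 * c), (a2 * c).
have E (u : nat -> V) : series (fun n => u n * c) = (fun n => series u n * c).
  by apply/funext => n; rewrite /series/= mulr_suml.
by rewrite !E mulrDl; split=> //; apply: cvg_mul_banach => //; exact: cvg_cst.
Qed.

Lemma has_bsum_shift f a : has_bsum f a -> has_bsum (fun k => f (k + 1)) a.
Proof.
(* The term [f 0] moves from the nonnegative half to the negative one. *)
move=> [a1 [a2 [f1 f2 ->]]]; exists (a1 - f 0), (f 0 + a2).
split; last by rewrite addrA subrK.
- have -> : series (fun n : nat => f (n%:Z + 1)) =
      (fun n => series (fun n : nat => f n%:Z) n.+1 - f 0).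
    apply/funext => n; rewrite /series/= big_nat_recl//= addrC addKr.
    by apply: eq_bigr => i _; rewrite -addn1 PoszD.
  apply: cvgB; last exact: cvg_cst.
  by rewrite (cvg_shiftS (series (fun n : nat => f n%:Z))).
- rewrite -cvg_shiftS.
  have -> : [sequence series (fun n : nat => f (- n.+1%:Z + 1)) n.+1]_n =
      (fun n => f 0 + series (fun n : nat => f (- n.+1%:Z)) n).
    apply/funext => n; rewrite /series/= big_nat_recl//=; congr (_ + _).
    by apply: eq_bigr => i _; congr f; rewrite -addn1 PoszD opprD subrK.
  by apply: cvgD => //; exact: cvg_cst.
Qed.

Lemma geom_has_bsum f (K s : R) : 0 <= s < 1 ->
  (forall k, `|f k| <= K * s ^+ `|k|%N) -> has_bsum f (bilateral_sum f).
Proof.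
move=> s01 fK; apply/has_bsumP; split=> //; have /andP[s0 s1] := s01.
have K0 : 0 <= K by have := fK 0; rewrite mulr1; exact: le_trans (normr_ge0 _).
split; apply: (cvgn_geom s01 (K := K)) => k; apply: le_trans (fK _) _ => //.
by rewrite abszN ler_wpM2l// exprS ler_piMl ?exprn_ge0// ltW.
Qed.

Lemma bsum_tannery (f : nat -> int -> V) g (K s : R) : 0 <= s < 1 ->
  (forall n k, `|f n k| <= K * s ^+ `|k|%N) ->
  (forall k, f ^~ k @ \oo --> g k) ->
  bilateral_sum (f n) @[n --> \oo] --> bilateral_sum g.
Proof.
move=> s01 fK fg; have /andP[s0 s1] := s01.
have K0 : 0 <= K.
  by have := fK 0%N 0; rewrite mulr1; exact: le_trans (normr_ge0 _).
apply: cvgD; apply: (tannery s01 (K := K)) => // n k.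
apply: le_trans (fK _ _) _ => //.
by rewrite abszN ler_wpM2l// exprS ler_piMl ?exprn_ge0// ltW.
Qed.

End BilateralSums.

(** * Convergence of noncommutative infinite products *)

Section InfiniteProducts.
Context (R : realType) (V : banachAlgType R).
Implicit Types (x y : nat -> V) (Q z : V).

Lemma norm_mulX z Q n : `|z * Q ^+ n| <= `|z| * `|Q| ^+ n.
Proof.
elim: n => [|n IH]; first by rewrite !mulr1.
rewrite exprSr mulrA exprSr mulrA; apply: le_trans (ler_normM_banach _ _) _.
by rewrite ler_wpM2r.
Qed.

Lemma unitr_1B z : `|z| < 1 -> 1 - z \is a GRing.unit.
Proof.
move=> z1; have s01 : 0 <= `|z| < 1 by rewrite normr_ge0.
have zK n : `|z ^+ n| <= `|1 : V| * `|z| ^+ n.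
  by rewrite -[z ^+ n]mul1r norm_mulX.
have cS := cvgn_geom s01 zK.
have z0 : z ^+ n @[n --> \oo] --> (0 : V).
  apply: norm_cvg0; apply: (@squeeze_cvgr _ _ _ _ (cst 0)
    (geometric `|1 : V| `|z|)); first by apply: nearW => n /=; rewrite zK normr_ge0.
  - exact: cvg_cst.
  - by apply: cvg_geometric; rewrite normr_id.
have c1 : (1 - z ^+ n) @[n --> \oo] --> (1 : V).
  have : (1 - z ^+ n) @[n --> \oo] --> (1 - 0 : V).
    by apply: cvgB => //; exact: cvg_cst.
  by rewrite subr0.
set S := limn (series (fun n => z ^+ n)).
have e1 : (1 - z) * S = 1.
  apply/esym; rewrite -[LHS](cvg_lim _ c1)//; apply: cvg_lim => //.
  have -> : (fun n => 1 - z ^+ n) =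
      (fun n => (1 - z) * series (fun n => z ^+ n) n).
    apply/funext => n; rewrite /series/= big_mkord.
    by apply: oppr_inj; rewrite -mulNr !opprB -subrX1.
  apply: cvg_mul_banach => //; exact: cvg_cst.
have e2 : S * (1 - z) = 1.
  apply/esym; rewrite -[LHS](cvg_lim _ c1)//; apply: cvg_lim => //.
  have -> : (fun n => 1 - z ^+ n) =
      (fun n => series (fun n => z ^+ n) n * (1 - z)).
    apply/funext => n; rewrite /series/= big_mkord.
    apply: oppr_inj; rewrite -mulrN !opprB subrX1.
    apply: commr_sum => i _; apply/commrX/commr_sym/commrB => //.
    exact: commr1.
  apply: cvg_mul_banach => //; exact: cvg_cst.
by apply/unitrP; exists S.
Qed.

(** A geometric rate rather than mere convergence: it survives products and inverses, and it is the
    error term that [growth_bound] accepts. *)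
Definition near1 (r : R) x := exists C, 0 <= C /\
  forall n, `|x n - 1| <= C * r ^+ n.

Context (r : R) (r01 : 0 <= r < 1).

Let r0 : 0 <= r. Proof. by case/andP: r01. Qed.
Let r1 : r < 1. Proof. by case/andP: r01. Qed.
Let rX n : r ^+ n <= 1. Proof. by rewrite exprn_ile1// ltW. Qed.

Lemma near1M x y : near1 r x -> near1 r y -> near1 r (fun n => x n * y n).
Proof.
move=> [C [C0 xC]] [D [D0 yD]]; exists (C * (`|1 : V| + D) + D).
split=> [|n]; first by rewrite addr_ge0// mulr_ge0// addr_ge0.
have -> : x n * y n - 1 = (x n - 1) * y n + (y n - 1).
  by rewrite mulrBl mul1r addrA subrK.
apply: le_trans (ler_normD _ _) _; rewrite [leRHS]mulrDl lerD//.
apply: le_trans (ler_normM_banach _ _) _; rewrite mulrAC ler_pM//.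
rewrite -[y n](subrKC 1); apply: le_trans (ler_normD _ _) _.
by rewrite lerD2l; apply: le_trans (yD n) _; rewrite ler_piMr.
Qed.

Lemma near1_inv_bounded x : near1 r x -> (forall n, x n \is a GRing.unit) ->
  exists M, forall n, `|(x n)^-1| <= M.
Proof.
move=> [C [C0 xC]] ux.
have : geometric C r @ \oo --> (0 : R) by apply: cvg_geometric; rewrite ger0_norm.
move/cvgrPdist_le => /(_ (1 / 2) ltac:(by []))[N _ hN].
(* Beyond [N], x^-1 = 1 - (x - 1) x^-1 gives |x^-1| <= |1| + |x^-1| / 2, hence the bound 2 |1|,
   where |1| may differ from 1. The finite sum covers the indices below [N]. *)
exists (`|1 : V| * 2 + \sum_(i < N) `|(x i)^-1|) => n.
have [nN|Nn] := ltnP n N.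
  rewrite -[leLHS]add0r lerD ?mulr_ge0// (bigD1 (Ordinal nN))//= lerDl.
  exact: sumr_ge0.
rewrite -[leLHS]addr0 lerD ?sumr_ge0//.
have := hN n Nn; rewrite /= sub0r normrN ger0_norm ?mulr_ge0 ?exprn_ge0// => h.
have : `|(x n)^-1| <= `|1 : V| + 1 / 2 * `|(x n)^-1|.
  have {1}-> : (x n)^-1 = 1 - (x n - 1) * (x n)^-1.
    by rewrite mulrBl mulrV// mul1r subKr.
  apply: le_trans (ler_normB _ _) _; rewrite lerD2l.
  apply: le_trans (ler_normM_banach _ _) _; rewrite ler_wpM2r//.
  exact: le_trans (xC n) h.
by lra.
Qed.

Lemma near1V x : near1 r x -> (forall n, x n \is a GRing.unit) ->
  near1 r (fun n => (x n)^-1).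
Proof.
move=> x1 ux; have [M xM] := near1_inv_bounded x1 ux; case: x1 => C [C0 xC].
have M0 : 0 <= M by apply: le_trans (xM 0%N).
exists (M * C); split=> [|n]; first exact: mulr_ge0.
have -> : (x n)^-1 - 1 = - ((x n)^-1 * (x n - 1)).
  by rewrite mulrBr mulVr// mulr1 opprB.
by rewrite normrN -mulrA; apply: le_trans (ler_normM_banach _ _) _; rewrite ler_pM.
Qed.

Lemma near1_1BX z Q : `|Q| <= r -> near1 r (fun n => 1 - z * Q ^+ n).
Proof.
move=> Qr; exists `|z|; split=> // n.
rewrite addrC addKr normrN; apply: le_trans (norm_mulX _ _ _) _.
by rewrite ler_wpM2l// lerXn2r// nnegrE.
Qed.

(** Two passes: [growth_bound] with s = 1 bounds [P]; then the increments are geometrically small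
    and the telescoping series converges. Only norms occur, so this serves products growing on
    either side. *)
Lemma small_steps_cvg (P : nat -> V) (C : R) : 0 <= C ->
  (forall n, `|P n.+1 - P n| <= C * r ^+ n * `|P n|) -> cvgn P.
Proof.
move=> C0 PS.
have Pb n : `|P n| <= `|P 0%N| * expR (C / 1 / (1 - r)).
  have := @growth_bound _ r C 1 (fun n => `|P n|) r01 C0 ltr01 (fun n => normr_ge0 _).
  move=> /(_ _ n); rewrite expr1n mulr1; apply => k.
  rewrite mulrDl mul1r -[P k.+1](subrKC (P k)); apply: le_trans (ler_normD _ _) _.
  by rewrite lerD2l.
have cT : cvgn (series (telescope P)).
  apply: (cvgn_geom r01 (K := C * (`|P 0%N| * expR (C / 1 / (1 - r))))) => n.
  apply: le_trans (PS n) _; rewrite [leRHS]mulrAC ler_wpM2l// mulr_ge0//.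
  exact: exprn_ge0.
rewrite telescopeK in cT.
have -> : P = (fun n => P 0%N + [sequence P n - P 0%N]_n n).
  by apply/funext => n /=; rewrite subrKC.
apply: is_cvgD => //; exact: is_cvg_cst.
Qed.

Lemma cvgn_prodr (P x : nat -> V) : near1 r x ->
  (forall n, P n.+1 = P n * x n) -> cvgn P.
Proof.
move=> [C [C0 xC]] PS; apply: (small_steps_cvg C0) => n.
rewrite PS -{2}[P n]mulr1 -mulrBr; apply: le_trans (ler_normM_banach _ _) _.
by rewrite mulrC ler_wpM2r.
Qed.

Lemma cvgn_prodl (P x : nat -> V) : near1 r x ->
  (forall n, P n.+1 = x n * P n) -> cvgn P.
Proof.
move=> [C [C0 xC]] PS; apply: (small_steps_cvg C0) => n.
rewrite PS -{2}[P n]mul1r -mulrBl; apply: le_trans (ler_normM_banach _ _) _.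
by rewrite ler_wpM2r.
Qed.

End InfiniteProducts.

(** * First-order recurrences over all integers *)

Section IntegerRecurrences.
Context (R : unitRingType).
Implicit Types (a b f g : int -> R).

Fixpoint ladder_up a b n : R :=
  if n is m.+1 then (a m)^-1 * (b m * ladder_up a b m) else 1.

Fixpoint ladder_down a b n : R :=
  if n is m.+1 then (b (Negz m))^-1 * (a (Negz m) * ladder_down a b m) else 1.

(* The solution of [a k * f (k + 1) = b k * f k] with [f 0 = 1], built upwards
   from the inverses of the [a k], [k >= 0], and downwards from those of the
   [b k], [k < 0]; the other [a k] and [b k] need not be invertible. *)
Definition ladder a b (k : int) : R :=
  match k with Posz n => ladder_up a b n | Negz n => ladder_down a b n.+1 end.

Lemma Negz_add1 n : Negz n.+1 + 1 = Negz n.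
Proof. by rewrite !NegzE -addn1 PoszD opprD subrK. Qed.

Lemma ladder_rec a b :
  (forall n : nat, a n%:Z \is a GRing.unit) ->
  (forall n : nat, b (Negz n) \is a GRing.unit) ->
  forall k, a k * ladder a b (k + 1) = b k * ladder a b k.
Proof.
move=> ua ub [n|[|n]].
- by rewrite -PoszD addn1 /= mulVKr.
- by rewrite /= mulVKr.
- by rewrite Negz_add1 /= mulVKr.
Qed.

Lemma int_rec_unique a b f g :
  (forall n : nat, a n%:Z \is a GRing.unit) ->
  (forall n : nat, b (Negz n) \is a GRing.unit) ->
  f 0 = g 0 ->
  (forall k, a k * f (k + 1) = b k * f k) ->
  (forall k, a k * g (k + 1) = b k * g k) -> f =1 g.
Proof.
move=> ua ub fg0 fS gS.
have pos (n : nat) : f n%:Z = g n%:Z.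
  elim: n => [//|n IH]; apply: (mulrI (ua n)).
  by have := fS n%:Z; have := gS n%:Z; rewrite -PoszD addn1 IH => -> ->.
case=> // n; elim: n => [|n IH].
  by apply: (mulrI (ub 0%N)); rewrite -fS -gS fg0.
by apply: (mulrI (ub n.+1)); rewrite -fS -gS Negz_add1 IH.
Qed.

End IntegerRecurrences.

Lemma cvgn_int_shift (T : ptopologicalType) (f : int -> T) (l : T) :
  (fun n : nat => f n%:Z) @ \oo --> l ->
  forall k : int, (fun n : nat => f (n%:Z - k)) @ \oo --> l.
Proof.
move=> fl [m|m].
- rewrite -(cvg_shiftn m); under eq_fun do rewrite PoszD addrK; exact: fl.
- under eq_fun do rewrite NegzE opprK -PoszD.
  by move: fl; rewrite -(cvg_shiftn m.+1); exact.
Qed.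

Lemma cvgn_norm_bounded (R : realType) (V : normedModType R) (f : nat -> V) :
  cvgn f -> exists M, forall n, `|f n| <= M.
Proof.
move=> /cvg_seq_bounded[M [_ hM]]; exists (M + 1) => n.
by apply: hM => //; rewrite ltrDl.
Qed.

Lemma commrXz (R : unitRingType) (x y : R) (k : int) :
  GRing.comm x y -> GRing.comm x (y ^ k).
Proof.
by case: k => n cxy; [exact: commrX|apply: commrV; exact: commrX].
Qed.

(** * The weighted sums and the core summation, with [al] in the role of A^-1 *)

Section Core.
Context (R : realType) (V : banachAlgType R) (Q al X B : V).
Context (hQ1 : `|Q| < 1) (uQ : Q \is a GRing.unit) (uX : X \is a GRing.unit).
Context (cXQ : GRing.comm X Q) (cBQ : GRing.comm B Q).
Context (cXa : GRing.comm X al) (cBa : GRing.comm B al) (cQa : GRing.comm Q al).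
Context (uB : forall n : nat, 1 - B * Q ^+ n \is a GRing.unit).
Context (hz : `|al * X| < 1) (hy : `|X^-1 * B| < 1).

Let r01 : 0 <= `|Q| < 1. Proof. by rewrite normr_ge0. Qed.

(* [y] lies in the bicommutant of [Q] and [al]: this is the form of "central"
   available here, and it is stable under the ring operations and inverses. *)
Definition bicommutes (y : V) := forall w, GRing.comm w Q -> GRing.comm w al ->
  GRing.comm w y.

Let ctr1 : bicommutes 1. Proof. by move=> w _ _; exact: commr1. Qed.
Let ctrQ : bicommutes Q. Proof. by []. Qed.
Let ctra : bicommutes al. Proof. by []. Qed.
Let ctrM x y : bicommutes x -> bicommutes y -> bicommutes (x * y).
Proof. by move=> cx cy w wQ wa; apply: commrM; [exact: cx|exact: cy]. Qed.
Let ctrB x y : bicommutes x -> bicommutes y -> bicommutes (x - y).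
Proof. by move=> cx cy w wQ wa; apply: commrB; [exact: cx|exact: cy]. Qed.
Let ctrV x : bicommutes x -> bicommutes x^-1.
Proof. by move=> cx w wQ wa; apply: commrV; exact: cx. Qed.
Let ctrXz x k : bicommutes x -> bicommutes (x ^ k).
Proof. by move=> cx w wQ wa; apply: commrXz; exact: cx. Qed.
Let ctrC x y : bicommutes x -> bicommutes y -> x * y = y * x.
Proof.
move=> cx cy; apply: cy; first by apply/commr_sym/cx.
by apply/commr_sym/cx => //; exact: commr_sym.
Qed.
Let ctrXC y : bicommutes y -> X * y = y * X. Proof. exact. Qed.
Let ctrBC y : bicommutes y -> B * y = y * B. Proof. exact. Qed.

Let norm_Xmul n (y : V) : `|Q ^+ n * y| <= `|Q| ^+ n * `|y|.
Proof.
elim: n => [|n IH]; first by rewrite !mul1r.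
rewrite exprS -mulrA exprS -mulrA; apply: le_trans (ler_normM_banach _ _) _.
by rewrite ler_wpM2l.
Qed.

Lemma near1_1BXS (z : V) : near1 `|Q| (fun n => 1 - z * Q ^+ n.+1).
Proof.
have := near1_1BX r01 (z * Q) (lexx `|Q|).
by under eq_fun do rewrite -mulrA -exprS.
Qed.

(* [weight b j] is [1 / (bQ; Q)_j] extended to negative [j]; for [b = 1] it
   vanishes at [j < 0], which truncates the bilateral sums below. *)
Definition weight (b : V) : int -> V :=
  ladder (fun k => 1 - b * Q ^ (k + 1)) (fun=> 1).

Section Weights.
Context (b : V) (cb : bicommutes b).
Context (ub : forall n : nat, 1 - b * Q ^+ n.+1 \is a GRing.unit).

Lemma weight_rec k : (1 - b * Q ^ (k + 1)) * weight b (k + 1) = weight b k.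
Proof.
rewrite -[RHS]mul1r; apply: (@ladder_rec _ (fun k => 1 - b * Q ^ (k + 1))).
  by move=> n; rewrite -PoszD addn1; exact: ub.
by move=> n; exact: unitr1.
Qed.

Lemma weight_ctr k : bicommutes (weight b k).
Proof.
have cf j : bicommutes (1 - b * Q ^ j) by apply/ctrB/ctrM => //; exact: ctrXz.
rewrite /weight /ladder; case: k => n.
  elim: n => [|n IH]; first exact: ctr1.
  by rewrite /= mul1r; apply: ctrM => //; exact: ctrV.
elim: n.+1 => [|m IH]; first exact: ctr1.
by rewrite /= invr1 mul1r; apply: ctrM.
Qed.

Lemma weight_natS (n : nat) :
  weight b n.+1 = (1 - b * Q ^+ n.+1)^-1 * weight b n.
Proof. by rewrite -(weight_rec n%:Z) -PoszD addn1 mulKr. Qed.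

Lemma cvgn_weight : cvgn (fun n : nat => weight b n).
Proof.
apply: (cvgn_prodl r01 _ weight_natS); apply: near1V => //.
exact: near1_1BXS.
Qed.

End Weights.

(* The limit as [A -> oo] with [X = AZ] fixed of the terms of the 1psi1. *)
Definition base : int -> V := ladder (fun k => 1 - B * Q ^ k) (fun k => - (X * Q ^ k)).

Lemma base_rec k : (1 - B * Q ^ k) * base (k + 1) = - (X * Q ^ k) * base k.
Proof.
apply: (@ladder_rec _ (fun k => 1 - B * Q ^ k) (fun k => - (X * Q ^ k))) => // n.
by rewrite unitrN unitrMr ?unitrXz// unitrV unitrX.
Qed.

(** Multiplying [base_rec] by [Q ^ (- k)] leaves [k] only in a scalar coefficient, and that
    coefficient is absorbed by [weight_rec] in the recurrence below. *)
Lemma mulX_base k : X * base k = B * base (k + 1) - Q ^ (- k) * base (k + 1).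
Proof.
have eQ (w : V) : w * Q ^ (- k) = Q ^ (- k) * w -> Q ^ (- k) * (w * Q ^ k) = w.
  by move=> h; rewrite mulrA -h -mulrA -exprzDr// addNr mulr1.
have eX : Q ^ (- k) * (X * Q ^ k) = X by apply/eQ/ctrXC/ctrXz.
have eB : Q ^ (- k) * (B * Q ^ k) = B by apply/eQ/ctrBC/ctrXz.
rewrite -{1}eX -mulrA -[_ * base k]opprK -mulNr -base_rec.
by rewrite mulrN mulrBl mul1r mulrBr opprB mulrA eB.
Qed.

(* Summed over [k], this is a first-order recurrence in [n] for the sums
   [\sum_k weight b (n - k) * base k]. *)
Lemma weighted_base_rec b (n : nat) k : bicommutes b ->
  (forall n : nat, 1 - b * Q ^+ n.+1 \is a GRing.unit) ->
  (1 - b * B * Q ^+ n) * (weight b (n.+1%:Z - (k + 1)) * base (k + 1)) =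
  weight b (n%:Z - (k + 1)) * base (k + 1)
  - b * X * Q ^+ n * (weight b (n%:Z - k) * base k).
Proof.
move=> cb ub; have cE := weight_ctr cb (n%:Z - k).
have -> : n.+1%:Z - (k + 1) = n%:Z - k by rewrite -addn1 PoszD [k + 1]addrC addrKA.
have := weight_rec ub (n%:Z - (k + 1)).
have -> : n%:Z - (k + 1) + 1 = n%:Z - k by rewrite opprD addrA subrK.
move=> <-; move: (weight b (n%:Z - k)) cE => E cE.
have cQn : bicommutes (Q ^+ n) by exact: (ctrXz n%:Z ctrQ).
have -> : b * X * Q ^+ n * (E * base k) = b * E * Q ^+ n * (X * base k).
  rewrite -!mulrA; congr (b * _).
  rewrite mulrA (ctrXC cQn) -!mulrA (mulrA X) (ctrXC cE) -!mulrA.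
  by rewrite !mulrA (ctrC cQn cE).
have eB : b * B * Q ^+ n * (E * base (k + 1)) = b * E * Q ^+ n * (B * base (k + 1)).
  rewrite -!mulrA; congr (b * _).
  rewrite mulrA (ctrBC cQn) -!mulrA (mulrA B) (ctrBC cE) -!mulrA.
  by rewrite !mulrA (ctrC cQn cE).
have eQ : b * E * Q ^+ n * (Q ^ (- k) * base (k + 1)) =
    b * Q ^ (n%:Z - k) * E * base (k + 1).
  rewrite exprzDr// -!mulrA; congr (b * _).
  have cQ : bicommutes (Q ^+ n * Q ^ (- k)) by apply: ctrM => //; exact: ctrXz.
  by rewrite !mulrA -[E * _ * _]mulrA (ctrC cE cQ).
rewrite mulX_base (mulrBr (b * E * Q ^+ n)) eQ !mulrBl !mul1r eB.
by rewrite opprB addrA subrK.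
Qed.

(** A common decay rate: |al X| governs the weighted terms as k -> +oo, |X^-1 B| governs k -> -oo.
    The floor 1/2 keeps [s] positive, since [growth_bound] divides by it. *)
Let s := Num.max (Num.max `|al * X| `|X^-1 * B|) (1 / 2).

Let s_gt0 : 0 < s. Proof. by rewrite lt_max; apply/orP; right; lra. Qed.
Let s01 : 0 <= s < 1. Proof. by rewrite ltW//= !gt_max hz hy/=; lra. Qed.
Let hzs : `|al * X| <= s. Proof. by rewrite !le_max lexx. Qed.
Let hys : `|X^-1 * B| <= s. Proof. by rewrite !le_max lexx orbT. Qed.
Let r0 : 0 <= `|Q|. Proof. exact: normr_ge0. Qed.

Let uBr (n : nat) : base n.+1 = (1 - B * Q ^+ n)^-1 * (- (X * Q ^+ n) * base n).
Proof. by have := base_rec n; rewrite -PoszD addn1 => <-; rewrite mulKr. Qed.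

Let UN (n : nat) : base (- n.+1%:Z) =
  X^-1 * B * base (- n%:Z) - X^-1 * (Q ^+ n.+1 * base (- n%:Z)).
Proof.
have := mulX_base (- n.+1%:Z).
have -> : - n.+1%:Z + 1 = - n%:Z by rewrite -addn1 PoszD opprD subrK.
by rewrite opprK -mulrA -mulrBr => <-; rewrite mulKr.
Qed.

(** Upwards each step carries a factor [Q ^+ n], so the ratio tends to 0; downwards it is X^-1 B up
    to an error of order |Q|^n. *)
Lemma base_bound : exists K, forall k, `|base k| <= K * s ^+ `|k|%N.
Proof.
have [M hM] := near1_inv_bounded r01 (near1_1BX r01 B (lexx _)) uB.
have M0 : 0 <= M by apply: le_trans (hM 0%N).
have C0 : 0 <= M * `|X| by rewrite mulr_ge0.
have up := growth_bound r01 C0 s_gt0 (fun n => normr_ge0 (base n%:Z)).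
have down := growth_bound r01 (normr_ge0 X^-1) s_gt0
  (fun n => normr_ge0 (base (- n%:Z))).
have {}up := up _; have {}down := down _.
set K1 := _ * expR (M * _ / _ / _) in up; set K2 := _ * expR (`|X^-1| / _ / _) in down.
have K10 : 0 <= K1 by rewrite mulr_ge0// expR_ge0.
have K20 : 0 <= K2 by rewrite mulr_ge0// expR_ge0.
exists (K1 + K2) => -[n|n]; rewrite mulrDl.
  rewrite -[leLHS]addr0 lerD ?mulr_ge0 ?exprn_ge0 ?(ltW s_gt0)//.
  apply: up => k; rewrite uBr; apply: le_trans (ler_normM_banach _ _) _.
  rewrite mulrDl ler_wpDl ?mulr_ge0// ?(ltW s_gt0)// -!mulrA ler_pM//.
  rewrite mulNr normrN -!mulrA; apply: le_trans (ler_normM_banach _ _) _.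
  by rewrite ler_wpM2l.
rewrite NegzE -[leLHS]add0r lerD ?mulr_ge0 ?exprn_ge0 ?(ltW s_gt0)//.
apply: down => k; rewrite UN; apply: le_trans (ler_normB _ _) _.
rewrite mulrDl lerD//.
  by apply: le_trans (ler_normM_banach _ _) _; rewrite ler_wpM2r.
apply: le_trans (ler_normM_banach _ _) _; rewrite -mulrA ler_wpM2l//.
apply: le_trans (norm_Xmul _ _) _; rewrite ler_wpM2r//.
by rewrite exprS ler_piMl ?exprn_ge0 ?(ltW hQ1).
Qed.

(** The bound uniform in [n] serves twice, for the convergence of each [H n] and as the domination
    in the limit. Shift invariance turns the termwise relation into the recurrence. Neither side of
    it is divided out, because b = 1 and b = al solve it in opposite directions. *)
Lemma weighted_sums b : bicommutes b ->
  (forall n : nat, 1 - b * Q ^+ n.+1 \is a GRing.unit) ->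
  (exists K, forall (n : nat) k,
    `|weight b (n%:Z - k) * base k| <= K * s ^+ `|k|%N) ->
  let H (n : nat) := bilateral_sum (fun k => weight b (n%:Z - k) * base k) in
  [/\ forall n : nat, has_bsum (fun k => weight b (n%:Z - k) * base k) (H n),
      forall n, (1 - b * B * Q ^+ n) * H n.+1 = (1 - b * X * Q ^+ n) * H n &
      H @ \oo --> limn (fun n : nat => weight b n) * bilateral_sum base].
Proof.
move=> cb ub [K hK] H.
have hH (n : nat) : has_bsum (fun k => weight b (n%:Z - k) * base k) (H n).
  exact: (geom_has_bsum s01 (hK n)).
split=> // [n|].
- apply: (@has_bsum_unique _ _
    (fun k => (1 - b * B * Q ^+ n) * (weight b (n.+1%:Z - (k + 1)) * base (k + 1)))).
    exact/has_bsumMl/(has_bsum_shift (hH n.+1)).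
  under eq_fun do rewrite weighted_base_rec//.
  rewrite mulrBl mul1r; apply: has_bsumB; last exact: has_bsumMl.
  exact: (has_bsum_shift (hH n)).
- set e := limn _; have ce : (fun n : nat => weight b n) @ \oo --> e.
    exact: cvgn_weight.
  have [KU hU] := base_bound.
  have /has_bsumP[_ <-] := has_bsumMl e (geom_has_bsum s01 hU).
  apply: (bsum_tannery s01 hK) => k; apply: cvg_mul_banach; last exact: cvg_cst.
  exact: cvgn_int_shift.
Qed.

(** The commutant to which [bicommutes] refers: [X], [B] and the factors built from them lie in it,
    and [frC] lets central elements pass through them. *)
Definition commutes_Qal (w : V) := GRing.comm Q w /\ GRing.comm al w.

Let fr1B w : commutes_Qal w -> commutes_Qal (1 - w).
Proof. by case=> *; split; apply: commrB => //; exact: commr1. Qed.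
Let frM w y : commutes_Qal w -> commutes_Qal y -> commutes_Qal (w * y).
Proof. by move=> [? ?] [? ?]; split; exact: commrM. Qed.
Let frV w : commutes_Qal w -> commutes_Qal w^-1.
Proof. by move=> [? ?]; split; exact: commrV. Qed.
Let frX : commutes_Qal X. Proof. by split; exact: commr_sym. Qed.
Let frB : commutes_Qal B. Proof. by split; exact: commr_sym. Qed.
Let frctr y : bicommutes y -> commutes_Qal y.
Proof. by move=> cy; split; apply: cy => //; exact: commr_sym. Qed.
Let frQn (n : nat) : commutes_Qal (Q ^+ n).
Proof. by apply/frctr/(ctrXz n%:Z). Qed.
Let frC w y : commutes_Qal w -> bicommutes y -> w * y = y * w.
Proof. by move=> [wQ wa] cy; apply: cy; exact: commr_sym. Qed.

(** For k > n the weight has a negative index and may grow like a product of powers of Q^-1, so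
    weight and base cannot be bounded separately. The ratio of their products has norm at most |b X|
    up to a geometric error in [k], uniformly in [n]. *)
Let weighted_base_natS b (n k : nat) : bicommutes b ->
  (forall n : nat, 1 - b * Q ^+ n.+1 \is a GRing.unit) ->
  weight b (n%:Z - k.+1%:Z) * base k.+1 = (1 - B * Q ^+ k)^-1 *
    ((b * X * Q ^+ n - X * Q ^+ k) * (weight b (n%:Z - k%:Z) * base k)).
Proof.
move=> cb ub; have cE := weight_ctr cb (n%:Z - k%:Z).
have := weight_rec ub (n%:Z - k.+1%:Z).
have -> : n%:Z - k.+1%:Z + 1 = n%:Z - k%:Z.
  by rewrite -addn1 PoszD opprD addrA subrK.
move=> <-; move: (weight b _) cE => E cE.
have cQz j : bicommutes (Q ^ j) by exact: ctrXz.
have cF : bicommutes (1 - b * Q ^ (n%:Z - k%:Z)) by apply/ctrB => //; exact: ctrM.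
have fx : commutes_Qal (1 - B * Q ^+ k)^-1 by apply/frV/fr1B/frM.
have fX : commutes_Qal (X * Q ^+ k) by exact: frM.
rewrite uBr [LHS]mulrA -(frC fx (ctrM cF cE)) -mulrA; congr (_ * _).
rewrite [LHS]mulrA [RHS]mulrA; congr (_ * _).
rewrite mulrN -(frC fX (ctrM cF cE)) mulrA -mulNr; congr (_ * _).
rewrite mulrBr mulr1 opprB; congr (_ - _).
have -> : Q ^+ n = Q ^ (n%:Z - k%:Z) * Q ^+ k.
  by rewrite -[Q ^+ k]/(Q ^ k) -exprzDr// subrK.
rewrite -!mulrA (ctrC (cQz k) (ctrM cb (cQz _))) !mulrA; congr (_ * _ * _).
by rewrite ctrXC.
Qed.

Let near1_bounded b : bicommutes b ->
  (forall n : nat, 1 - b * Q ^+ n.+1 \is a GRing.unit) ->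
  exists M, 0 <= M /\ forall n : nat, `|weight b n| <= M.
Proof.
move=> cb ub; have [M hM] := cvgn_norm_bounded (cvgn_weight ub).
by exists M; split=> //; exact: le_trans (hM 0%N).
Qed.

(** For k >= 0 the terms are compared with the one at k = 0, which is [weight al n] and bounded in
    [n]. For k < 0 the index n - k is positive and the weights themselves are bounded. *)
Lemma weighted_base_bound : (forall n : nat, 1 - al * Q ^+ n.+1 \is a GRing.unit) ->
  exists K, forall (n : nat) k, `|weight al (n%:Z - k) * base k| <= K * s ^+ `|k|%N.
Proof.
move=> ua; have [M [M0 hM]] := near1_bounded ctra ua; have [KU hU] := base_bound.
have KU0 : 0 <= KU by have := hU 0; rewrite mulr1; exact: le_trans (normr_ge0 _).
have [D [D0 hD]] := near1V r01 (near1_1BX r01 B (lexx _)) uB.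
(* The constant comes from expanding (1 + D r^k) (s + |X| r^k) with r = |Q| and bounding r^(2k) by
   r^k. *)
have C0 : 0 <= `|X| + D * (s + `|X|) by rewrite addr_ge0// mulr_ge0// addr_ge0// ltW.
set e := expR ((`|X| + D * (s + `|X|)) / s / (1 - `|Q|)).
exists (M * e + M * KU) => n [k|k]; rewrite mulrDl.
- rewrite -[leLHS]addr0 lerD ?mulr_ge0 ?exprn_ge0 ?(ltW s_gt0)//.
  apply: (@le_trans _ _ (`|weight al (n%:Z - 0%N%:Z) * base 0%N| * e *
    s ^+ k)); last first.
    by rewrite subr0 mulr1 !ler_wpM2r ?exprn_ge0 ?expR_ge0 ?(ltW s_gt0).
  apply: (growth_bound r01 C0 s_gt0
    (v := fun k : nat => `|weight al (n%:Z - k%:Z) * base k|)) => // {}k.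
  rewrite weighted_base_natS//; set u := weight _ _ * _.
  set w := (_ - _) * u; set rk := `|Q| ^+ k.
  have rk0 : 0 <= rk by rewrite exprn_ge0.
  have rk1 : rk <= 1 by rewrite exprn_ile1// ltW.
  have hw : `|w| <= (s + `|X| * rk) * `|u|.
    apply: le_trans (ler_normM_banach _ _) _; rewrite ler_wpM2r//.
    apply: le_trans (ler_normB _ _) _; rewrite lerD ?norm_mulX//.
    apply: le_trans (norm_mulX _ _ _) _; apply: le_trans hzs.
    by rewrite ler_piMr// exprn_ile1// ltW.
  have -> : (1 - B * Q ^+ k)^-1 * w = w + ((1 - B * Q ^+ k)^-1 - 1) * w.
    by rewrite mulrBl mul1r subrKC.
  apply: le_trans (ler_normD _ _) _.
  apply: (@le_trans _ _ ((1 + D * rk) * `|w|)).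
    rewrite [leRHS]mulrDl mul1r lerD2l; apply: le_trans (ler_normM_banach _ _) _.
    by rewrite ler_wpM2r.
  apply: (@le_trans _ _ ((1 + D * rk) * ((s + `|X| * rk) * `|u|))).
    by rewrite ler_wpM2l// addr_ge0// mulr_ge0.
  rewrite mulrA ler_wpM2r//.
  have : D * `|X| * rk * rk <= D * `|X| * rk * 1.
    by rewrite ler_wpM2l// !mulr_ge0.
  by rewrite -subr_ge0 => h; rewrite -subr_ge0; apply: le_trans h _; lra.
- rewrite -[leLHS]add0r lerD ?mulr_ge0 ?exprn_ge0 ?expR_ge0 ?(ltW s_gt0)//.
  apply: le_trans (ler_normM_banach _ _) _; rewrite -mulrA ler_pM//.
  by rewrite NegzE opprK -PoszD.
Qed.

(** * The case b = 1: a one-sided q-binomial sum *)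

Let u1 (n : nat) : 1 - 1 * Q ^+ n.+1 \is a GRing.unit.
Proof.
rewrite mul1r unitr_1B// exprS; apply: le_lt_trans (norm_mulX _ _ _) _.
apply: le_lt_trans hQ1; rewrite ler_piMr// exprn_ile1//; exact: ltW.
Qed.

(** The step from 0 down to -1 multiplies by 1 - Q^0 = 0. *)
Lemma weight1_Negz n : weight 1 (Negz n) = 0.
Proof.
elim: n => [|n IH]; rewrite -(weight_rec u1); last by rewrite Negz_add1 IH mulr0.
by rewrite mul1r subrr mul0r.
Qed.

Lemma weighted1_base_bound : exists K, forall (n : nat) k,
  `|weight 1 (n%:Z - k) * base k| <= K * s ^+ `|k|%N.
Proof.
have [M [M0 hM]] := near1_bounded ctr1 u1; have [KU hU] := base_bound.
exists (M * KU) => n k; apply: le_trans (ler_normM_banach _ _) _.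
rewrite -mulrA ler_pM//; case: (n%:Z - k) => j //.
by rewrite weight1_Negz normr0.
Qed.

(** The absolute value stands for -k: the two agree for k <= 0, where the weight can be nonzero, and
    a natural exponent makes the bound uniform in [j]. *)
Definition qbin_term (j : nat) (k : int) : V :=
  Q ^+ (j * `|k|%N) * (weight 1 (- k) * base k).

(* A noncommutative q-binomial theorem: at [b = 1, n = 0] only [k <= 0]
   contributes, and the sum factors on inserting the powers [Q ^ (- j k)]. *)
Lemma qbin_term_rec j k : X * (qbin_term j k - qbin_term j.+1 k) =
  Q ^+ j * (B * qbin_term j (k + 1) - Q * qbin_term j.+1 (k + 1)).
Proof.
have th0 i (n : nat) : qbin_term i n.+1%:Z = 0.
  by rewrite /qbin_term -NegzE weight1_Negz mul0r mulr0.
case: k => n.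
  rewrite -PoszD addn1 !th0 !mulr0 subr0 mulr0.
  by case: n => [|n]; rewrite ?th0 /qbin_term ?muln0 subrr mulr0.
have -> : Negz n + 1 = - n%:Z by rewrite NegzE -addn1 PoszD opprD subrK.
have XU := mulX_base (Negz n); rewrite NegzE opprK in XU.
have e1 : - n.+1%:Z + 1 = - n%:Z by rewrite -addn1 PoszD opprD subrK.
rewrite e1 in XU; rewrite /qbin_term NegzE !abszN !opprK !absz_nat.
have := weight_rec u1 n; rewrite -PoszD addn1 mul1r.
have cW := weight_ctr ctr1 n.+1; move: (weight 1 n.+1) cW => W cW <-.
have cQ i : bicommutes (Q ^+ i) by exact: (ctrXz i%:Z).
set u' := base (- n.+1%:Z) in XU *; set u := base (- n%:Z) in XU *.
have cF : bicommutes (1 - Q ^+ n.+1) by exact: ctrB.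
have -> : Q ^+ (j * n.+1) * (W * u') - Q ^+ (j.+1 * n.+1) * (W * u') =
    Q ^+ (j * n.+1) * ((1 - Q ^+ n.+1) * W) * u'.
  rewrite [(1 - _) * W]mulrBl mul1r mulrBr mulrBl -!mulrA; congr (_ - _).
  by rewrite !mulrA -exprD mulSn addnC.
have cG : bicommutes (Q ^+ (j * n.+1) * ((1 - Q ^+ n.+1) * W)).
  by apply/ctrM => //; exact: ctrM.
rewrite mulrA (frC frX cG) -mulrA XU.
move: ((1 - Q ^+ n.+1) * W) (ctrM cF cW) cG => {cF cW}E cE cG.
rewrite !mulrBr; congr (_ - _).
  rewrite [LHS]mulrA -(frC frB cG) mulnS exprD !mulrA.
  by rewrite (frC frB (cQ j)).
rewrite !mulrA -!exprSr -exprD; congr (_ * _).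
rewrite -mulrA -(ctrC (cQ _) cE) mulrA -exprD; congr (Q ^+ _ * _).
by rewrite -mulSnr mulnS.
Qed.

Lemma qbin_sum0 : bilateral_sum (qbin_term 0) =
  bilateral_sum (fun k => weight 1 (0%N%:Z - k) * base k).
Proof.
congr bilateral_sum; apply/funext => k.
by rewrite /qbin_term mul0n mul1r sub0r.
Qed.

Lemma qbin_term_bound : exists K, forall j k, `|qbin_term j k| <= K * s ^+ `|k|%N.
Proof.
have [K hK] := weighted1_base_bound; exists K => j k.
apply: le_trans (norm_Xmul _ _) _; have := hK 0%N k; rewrite sub0r.
by apply: le_trans; rewrite ler_piMl// exprn_ile1// ltW.
Qed.

Let uy (j : nat) : 1 - X^-1 * B * Q ^+ j \is a GRing.unit.
Proof.
apply: unitr_1B; apply: le_lt_trans (norm_mulX _ _ _) _; apply: le_lt_trans hy.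
by rewrite ler_piMr// exprn_ile1// ltW.
Qed.

Let uz (j : nat) : 1 - al * X * Q ^+ j \is a GRing.unit.
Proof.
apply: unitr_1B; apply: le_lt_trans (norm_mulX _ _ _) _; apply: le_lt_trans hz.
by rewrite ler_piMr// exprn_ile1// ltW.
Qed.

(** Summing [qbin_term_rec] gives X (S_j - S_(j+1)) = Q^j (B S_j - Q S_(j+1)). Solving for S_j
    divides by 1 - X^-1 B Q^j, which |X^-1 B| < 1 makes invertible. *)
Lemma qbin_sum_rec j : bilateral_sum (qbin_term j) =
  (1 - X^-1 * B * Q ^+ j)^-1 * (1 - X^-1 * Q ^+ j.+1)
  * bilateral_sum (qbin_term j.+1).
Proof.
have [K hK] := qbin_term_bound.
have hs i := geom_has_bsum s01 (hK i).
have e1 := has_bsumMl X (has_bsumB (hs j) (hs j.+1)).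
have e2 := has_bsumMl (Q ^+ j) (has_bsumB (has_bsumMl B (has_bsum_shift (hs j)))
  (has_bsumMl Q (has_bsum_shift (hs j.+1)))).
have {e2} : has_bsum (fun k => X * (qbin_term j k - qbin_term j.+1 k)) (Q ^+ j *
    (B * bilateral_sum (qbin_term j) - Q * bilateral_sum (qbin_term j.+1))).
  by under eq_fun do rewrite qbin_term_rec.
move=> /(has_bsum_unique e1) {e1}.
move: (bilateral_sum _) (bilateral_sum _) => a b.
move=> e; rewrite -mulrA; apply: (mulrI (uy j)); rewrite mulVKr ?uy//.
have {}e : b - a = X^-1 * B * Q ^+ j * b - X^-1 * Q ^+ j.+1 * a.
  rewrite -[LHS](mulKr uX) e !mulrBr !mulrA -[in LHS](mulrA X^-1).
  by rewrite -[Q ^+ j * B](frC frB (ctrXz j%:Z ctrQ)) -(mulrA X^-1 _ Q) -exprSr !mulrA.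
rewrite !mulrBl !mul1r -{1}(subrK a b) e.
by rewrite addrC -[in LHS](addrA _ (- _)) addKr addrC.
Qed.

(** For k != 0 the factor Q^(j |k|) kills the term in the limit, and the term at k = 0 is 1. *)
Lemma qbin_sum_cvg : bilateral_sum (qbin_term n) @[n --> \oo] --> (1 : V).
Proof.
have [K hK] := qbin_term_bound.
pose d (k : int) : V := if k == 0 then 1 else 0.
have -> : (1 : V) = bilateral_sum d.
  apply: (@has_bsum_unique _ _ d); last first.
    apply: (@geom_has_bsum _ _ _ `|1 : V| _ s01) => k; rewrite /d.
    by case: eqP => [->|_]; rewrite ?mulr1// normr0 mulr_ge0// exprn_ge0// ltW.
  exists 1, 0; split; last by rewrite addr0.
    rewrite -cvg_shiftS.
    have -> : [sequence series (fun n : nat => d n) n.+1]_n = cst 1.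
      apply/funext => n; rewrite /series/= big_nat_recl// /d eqxx big1 ?addr0//.
    exact: cvg_cst.
  have -> : series (fun n : nat => d (- n.+1%:Z)) = cst 0.
    by apply/funext => n; rewrite /series/= /d big1.
  exact: cvg_cst.
apply: (bsum_tannery s01 hK) => k; rewrite /d; case: eqP => [->|/eqP k0].
  under eq_fun do rewrite /qbin_term muln0 mul1r oppr0 mul1r; exact: cvg_cst.
apply: norm_cvg0; rewrite /qbin_term; set c := weight 1 (- k) * base k.
apply: (@squeeze_cvgr _ _ _ _ (cst 0) (geometric `|c| `|Q|)).
- apply: nearW => n; rewrite normr_ge0/=; apply: le_trans (norm_Xmul _ _) _.
  rewrite mulrC ler_wpM2l// ler_wiXn2l ?(ltW hQ1)//.
  by rewrite leq_pmulr// absz_gt0.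
- exact: cvg_cst.
- by apply: cvg_geometric; rewrite normr_id.
Qed.

(** Infinite products are identified through conserved quantities: a partial product times a
    remainder is constant in [n], hence equal to its limit. *)
Let cvgn_const (F : nat -> V) (a c : V) :
  (forall n, F n = c) -> F @ \oo --> a -> a = c.
Proof.
move=> Fc Fa; rewrite -(cvg_lim _ Fa)//; apply: cvg_lim => //.
have -> : F = cst c by apply/funext.
exact: cvg_cst.
Qed.

(** Since (1 - al Q^-k) (- Q^k) = al - Q^k, the weight restores the numerator factor that was lost
    in passing from the series to [base]. *)
Lemma weighted_sum_unique (f : int -> V) :
  (forall n : nat, 1 - al * Q ^+ n.+1 \is a GRing.unit) ->
  f 0 = 1 -> (forall k, (1 - B * Q ^ k) * f (k + 1) = (al - Q ^ k) * X * f k) ->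
  f = (fun k => weight al (0%N%:Z - k) * base k).
Proof.
move=> ua f0 fS; apply/funext.
apply: (@int_rec_unique _ (fun k => 1 - B * Q ^ k) (fun k => (al - Q ^ k) * X)) => //.
- move=> n; rewrite unitrMl//.
  have -> : al - Q ^ Negz n = - (1 - al * Q ^+ n.+1) * Q ^ Negz n.
    by rewrite opprB mulrBl mul1r -mulrA mulrV ?unitrX// mulr1.
  by rewrite unitrMl ?unitrV ?unitrX// unitrN.
- by rewrite f0 mulr1.
- move=> k /=; rewrite !sub0r; have cE := weight_ctr ctra (- k).
  have -> : weight al (- (k + 1)) = (1 - al * Q ^ (- k)) * weight al (- k).
    by rewrite -{1}[- k](subrK 1) -weight_rec// opprD subrK.
  have fF : commutes_Qal (1 - B * Q ^ k) by apply/fr1B/frM => //; apply/frctr/ctrXz.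
  have cF : bicommutes (1 - al * Q ^ (- k))
    by apply: ctrB => //; apply: ctrM => //; exact: ctrXz.
  have cG : bicommutes (al - Q ^ k) by apply: ctrB => //; exact: ctrXz.
  rewrite [LHS]mulrA (frC fF (ctrM cF cE)) -[LHS]mulrA base_rec.
  rewrite !(mulrA _ _ (base k)); congr (_ * _).
  rewrite -[RHS]mulrA (frC frX cE) [RHS]mulrA (ctrC cF cE) (ctrC cG cE).
  rewrite -[LHS]mulrA -[RHS]mulrA; congr (_ * _).
  rewrite (ctrXC (ctrXz k ctrQ)) -[- (Q ^ k * X)]mulNr mulrA; congr (_ * _).
  by rewrite mulrN mulrBl mul1r opprB -mulrA -exprzDr// addNr mulr1.
Qed.

(* For [al = A^-1], [X = AZ] the recurrence of [f] is that of the type I terms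
   conjugated by [Z], with [B] standing for [Z B Z^-1]. *)
Lemma psi_core (f : int -> V) (P1 P2 P3 : nat -> V) :
  (forall n : nat, 1 - al * Q ^+ n.+1 \is a GRing.unit) ->
  f 0 = 1 -> (forall k, (1 - B * Q ^ k) * f (k + 1) = (al - Q ^ k) * X * f k) ->
  P1 0%N = 1 -> (forall n, P1 n.+1 = P1 n *
    ((1 - al * Q ^+ n.+1)^-1 * (1 - Q ^+ n.+1) *
     ((1 - al * X * Q ^+ n)^-1 * (1 - al * B * Q ^+ n)))) ->
  P2 0%N = 1 -> (forall n, P2 n.+1 =
    (1 - B * Q ^+ n)^-1 * (1 - X * Q ^+ n) * P2 n) ->
  P3 0%N = 1 -> (forall n, P3 n.+1 = P3 n *
    ((1 - X^-1 * B * Q ^+ n)^-1 * (1 - X^-1 * Q ^+ n.+1))) ->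
  [/\ cvgn P1, cvgn P2, cvgn P3 & has_bsum f (limn P1 * limn P2 * limn P3)].
Proof.
move=> ua f0 fS P10 P1S P20 P2S P30 P3S.
have [hA HAS HAl] := weighted_sums ctra ua (weighted_base_bound ua).
have [h1 H1S H1l] := weighted_sums ctr1 u1 weighted1_base_bound.
rewrite (weighted_sum_unique ua f0 fS).
set HA := (fun n : nat =>
  bilateral_sum (fun k => weight al (n%:Z - k) * base k)) in hA HAS HAl.
set H1 := (fun n : nat =>
  bilateral_sum (fun k => weight 1 (n%:Z - k) * base k)) in h1 H1S H1l.
have n1 z := near1_1BX r01 z (lexx `|Q|).
have nQ : near1 `|Q| (fun n => 1 - Q ^+ n.+1).
  by have := near1_1BXS 1; under eq_fun do rewrite mul1r.
have c1 : cvgn P1.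
  apply: (cvgn_prodr r01 _ P1S); do !apply: near1M => //; apply: near1V => //.
  exact: near1_1BXS.
have c2 : cvgn P2.
  by apply: (cvgn_prodl r01 _ P2S); apply: near1M => //; apply: near1V.
have c3 : cvgn P3.
  apply: (cvgn_prodr r01 _ P3S); apply: near1M => //; first exact: near1V.
  exact: near1_1BXS.
split=> //.
have E3 : limn P3 = H1 0%N.
  rewrite /H1 -qbin_sum0 -[LHS]mulr1.
  apply: (cvgn_const (F := fun n => P3 n * bilateral_sum (qbin_term n))).
    by elim=> [|n IH]; rewrite ?P30 ?mul1r// P3S -mulrA -qbin_sum_rec.
  by apply: cvg_mul_banach => //; exact: qbin_sum_cvg.
have E2 : limn P2 * H1 0%N = limn (fun n : nat => weight 1 n) * bilateral_sum base.
  (* At b = 1 the recurrence is solved for H_(n+1), the factor 1 - B Q^n being invertible by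
     [uB]. *)
  have PE : (fun n => P2 n * H1 0%N) = H1.
    apply/funext; elim=> [|n IH]; first by rewrite P20 mul1r.
    rewrite P2S -!mulrA IH; have := H1S n; rewrite !mul1r => <-.
    by rewrite mulKr.
  have : (fun n => P2 n * H1 0%N) @ \oo --> limn P2 * H1 0%N.
    by apply: (cvg_mul_banach c2); exact: cvg_cst.
  by rewrite PE => /cvg_lim <- //; rewrite (cvg_lim _ H1l).
(* [d n] is (al Q; Q)_n: its product with [weight al n] is always 1, so its limit cancels the e_oo
   left by b = al. *)
pose d := fix d n := if n is m.+1 then (1 - al * Q ^+ m.+1) * d m else 1 : V.
have dS n : d n.+1 = (1 - al * Q ^+ n.+1) * d n by [].
have cd : cvgn d by apply: (cvgn_prodl r01 _ dS); exact: near1_1BXS.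
have cQn n : bicommutes (Q ^+ n) by exact: (ctrXz n%:Z).
have cF n : bicommutes (1 - al * Q ^+ n) by apply/ctrB => //; exact: ctrM.
have ctrd n : bicommutes (d n) by elim: n => [|n IH] //; rewrite dS; exact: ctrM.
have ctr1n n := weight_ctr ctr1 n.
have dw : limn d * limn (fun n : nat => weight al n) = 1.
  apply: (cvgn_const (F := fun n : nat => d n * weight al n)).
    elim=> [|n IH]; first by rewrite mul1r.
    rewrite -[LHS]/(d n.+1 * weight al n.+1%:Z) dS (ctrC (cF n.+1))// weight_natS//.
    by rewrite -mulrA mulVKr.
  by apply: cvg_mul_banach => //; exact: cvgn_weight.
(* The central part of each new factor of [P1] accounts for the change in [weight 1] and [d]. The
   rest is the recurrence at b = al solved for H_n, which divides by 1 - al X Q^n, invertible since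
   |al X| < 1. *)
have E1 : limn P1 * (limn (fun n : nat => weight 1 n) * (limn d *
    (limn (fun n : nat => weight al n) * bilateral_sum base))) = HA 0%N.
  apply: (cvgn_const (F := fun n : nat => P1 n * (weight 1 n * (d n * HA n)))).
    elim=> [|n IH]; first by rewrite P10 !mul1r.
    rewrite -[RHS]IH P1S -mulrA; congr (_ * _).
    have fz : commutes_Qal ((1 - al * X * Q ^+ n)^-1 * (1 - al * B * Q ^+ n)).
      have fa : commutes_Qal al by exact: frctr.
      by apply: frM; [apply: frV|]; apply: fr1B; apply: frM => //; exact: frM.
    have eH : (1 - al * X * Q ^+ n)^-1 * (1 - al * B * Q ^+ n) * HA n.+1 = HA n.
      by rewrite -mulrA HAS mulKr.
    have uq : 1 - Q ^+ n.+1 \is a GRing.unit by have := u1 n; rewrite mul1r.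
    have ew : (1 - Q ^+ n.+1) * weight 1 n.+1 = weight 1 n.
      by rewrite weight_natS// mul1r mulVKr.
    have cq : bicommutes (1 - Q ^+ n.+1) by exact: ctrB.
    have cw := ctrM (ctr1n n.+1) (ctrd n.+1).
    move: ((1 - al * X * Q ^+ n)^-1 * _) fz eH => zb fz eH.
    move: (weight 1 n.+1) (ctr1n n.+1) ew cw => w cw1 ew cw.
    rewrite (mulrA w) -[LHS]mulrA (mulrA zb) (frC fz cw).
    rewrite -(mulrA _ zb) eH dS (mulrA w) (ctrC cw1 (cF _)).
    rewrite -!mulrA (mulrA (1 - Q ^+ n.+1)) (ctrC cq (cF _)) -mulrA mulKr//.
    by rewrite (mulrA (1 - Q ^+ n.+1)) ew.
  apply: (cvg_mul_banach c1); apply: cvg_mul_banach; first exact: cvgn_weight.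
  exact: cvg_mul_banach.
rewrite (mulrA (limn d)) dw mul1r -E2 -E3 mulrA in E1.
by rewrite E1.
Qed.

(* The central factors of the product are moved from [P1] to [P2]. *)
Lemma psi_core2 (f : int -> V) (P1 P2 P3 : nat -> V) :
  (forall n : nat, 1 - al * Q ^+ n.+1 \is a GRing.unit) ->
  f 0 = 1 -> (forall k, (1 - B * Q ^ k) * f (k + 1) = (al - Q ^ k) * X * f k) ->
  P1 0%N = 1 -> (forall n, P1 n.+1 = P1 n *
     ((1 - al * X * Q ^+ n)^-1 * (1 - al * B * Q ^+ n))) ->
  P2 0%N = 1 -> (forall n, P2 n.+1 = ((1 - Q ^+ n.+1) * (1 - B * Q ^+ n)^-1) *
    ((1 - X * Q ^+ n) * (1 - al * Q ^+ n.+1)^-1) * P2 n) ->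
  P3 0%N = 1 -> (forall n, P3 n.+1 = P3 n *
    ((1 - X^-1 * B * Q ^+ n)^-1 * (1 - X^-1 * Q ^+ n.+1))) ->
  [/\ cvgn P1, cvgn P2, cvgn P3 & has_bsum f (limn P1 * limn P2 * limn P3)].
Proof.
move=> ua f0 fS P10 P1S P20 P2S P30 P3S.
pose a n := (1 - al * Q ^+ n.+1)^-1 * (1 - Q ^+ n.+1).
(* [P0 n] is the central quotient (Q; Q)_n / (al Q; Q)_n. *)
pose P0 := fix P0 n := if n is m.+1 then a m * P0 m else 1 : V.
pose P2' := fix P2' n :=
  if n is m.+1 then (1 - B * Q ^+ m)^-1 * (1 - X * Q ^+ m) * P2' m else 1 : V.
have P0S n : P0 n.+1 = a n * P0 n by [].
have P2'S n : P2' n.+1 = (1 - B * Q ^+ n)^-1 * (1 - X * Q ^+ n) * P2' n by [].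
have cQn n : bicommutes (Q ^+ n) by exact: (ctrXz n%:Z).
have cF n : bicommutes (1 - al * Q ^+ n)^-1 by apply/ctrV/ctrB => //; exact: ctrM.
have cG n : bicommutes (1 - Q ^+ n) by exact: ctrB.
have ca n : bicommutes (a n) by exact: ctrM.
have cP0 n : bicommutes (P0 n) by elim: n => [|n IH] //; rewrite P0S; exact: ctrM.
have fa : commutes_Qal al by exact: frctr.
have fP1 n : commutes_Qal (P1 n).
  elim: n => [|n IH]; first by rewrite P10; exact: frctr.
  rewrite P1S; apply/frM/frM => //; first apply: frV.
    by apply/fr1B/frM => //; exact: frM.
  by apply/fr1B/frM => //; exact: frM.
have P2E n : P2 n = P0 n * P2' n.
  elim: n => [|n IH]; first by rewrite P20 mul1r.
  have fB : commutes_Qal (1 - B * Q ^+ n)^-1 by apply/frV/fr1B/frM.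
  have fX : commutes_Qal (1 - X * Q ^+ n) by apply/fr1B/frM.
  rewrite P2S IH P0S P2'S; move: (P0 n) (P2' n) (cP0 n) => p0 p2 cp0.
  rewrite /a; move: fB fX.
  move: (1 - B * Q ^+ n)^-1 (1 - X * Q ^+ n) => u v fu fv.
  move: (1 - al * Q ^+ n.+1)^-1 (1 - Q ^+ n.+1) (cF n.+1) (cG n.+1).
  move=> x y cx cy.
  rewrite (frC fv cx) -!mulrA (mulrA u x) (frC fu cx) -!mulrA.
  rewrite (mulrA y x) (ctrC cy cx) -!mulrA (mulrA v p0) (frC fv cp0) -!mulrA.
  by rewrite (mulrA u p0) (frC fu cp0) -!mulrA.
have near1a : near1 `|Q| a.
  apply: near1M => //; first by apply: near1V => //; exact: near1_1BXS.
  by have := near1_1BXS 1; under eq_fun do rewrite mul1r.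
have c0 : cvgn P0 by apply: (cvgn_prodl r01 near1a).
have c1 : cvgn P1.
  have n1 z := near1_1BX r01 z (lexx `|Q|).
  by apply: (cvgn_prodr r01 _ P1S); apply: near1M => //; exact: near1V.
have P1'S n : P0 n.+1 * P1 n.+1 = P0 n * P1 n *
    (a n * ((1 - al * X * Q ^+ n)^-1 * (1 - al * B * Q ^+ n))).
  rewrite P0S P1S; move: (a n) (ca n) (P0 n) (cP0 n) => c cc p cp.
  rewrite (ctrC cc cp) -!mulrA; congr (_ * _).
  by rewrite (mulrA c (P1 n)) -(frC (fP1 n) cc) -!mulrA.
have P10' : P0 0%N * P1 0%N = 1 by rewrite P10 mulr1.
have [_ c2 c3 hf] := @psi_core f (fun n => P0 n * P1 n) P2' P3 ua f0 fS P10' P1'S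
  erefl P2'S P30 P3S.
have c01 := cvg_mul_banach c0 c1.
have c02 : P2 @ \oo --> limn P0 * limn P2'.
  by rewrite (_ : P2 = (fun n => P0 n * P2' n)); [exact: cvg_mul_banach|exact/funext].
split=> //; first by apply/cvg_ex; exists (limn P0 * limn P2').
rewrite (cvg_lim _ c02)//; rewrite (cvg_lim _ c01)// in hf.
have -> : limn P1 * (limn P0 * limn P2') = limn P0 * limn P1 * limn P2'; last by [].
rewrite mulrA; congr (_ * _); rewrite -(cvg_lim _ c01)//; apply/esym/cvg_lim => //.
rewrite (_ : (fun n => P0 n * P1 n) = (fun n => P1 n * P0 n)).
  exact: cvg_mul_banach.
by apply/funext => n; rewrite (frC (fP1 n)).
Qed.

End Core.

(** * Recurrences for the ordered products and shifted factorials *)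

Section OrderedProducts.
Context (K : numFieldType) (V : banachAlgType K).
Implicit Types (x X : int -> V).

Lemma oprod_nat X (n : nat) : oprod 1 n%:Z X = \prod_(0 <= i < n) X (1 + i%:Z).
Proof. by rewrite /oprod subrK. Qed.

Lemma oprod_oppn X (n : nat) :
  oprod 1 (- n%:Z) X = \prod_(0 <= i < n) (X (- i%:Z))^-1.
Proof.
case: n => [|n]; first by rewrite oppr0 oprod_nat !big_geq.
rewrite -NegzE /oprod subrK.
by apply: eq_bigr => i _; rewrite subrr sub0r.
Qed.

Lemma oprodI_natS x (n : nat) : oprod 1 n.+1%:Z (fun j => x (n.+1%:Z - j)) =
  x n%:Z * oprod 1 n%:Z (fun j => x (n%:Z - j)).
Proof.
rewrite !oprod_nat big_nat_recl// addr0 intS [1 + _]addrC addrK; congr (_ * _).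
by apply: eq_bigr => i _; congr x; rewrite !intS; ring.
Qed.

Lemma oprodII_natS x (n : nat) : oprod 1 n.+1%:Z (fun j => x (j - 1)) =
  oprod 1 n%:Z (fun j => x (j - 1)) * x n%:Z.
Proof. by rewrite !oprod_nat big_nat_recr//= addrC addKr. Qed.

(** In type I the factors are indexed by k - j, so a step in [k] adds a factor on the left. For
    negative [k] it instead cancels the leftmost inverse, whence the units at negative indices. *)
Lemma oprodI_rec x : (forall n, x (Negz n) \is a GRing.unit) ->
  forall k, oprod 1 (k + 1) (fun j => x (k + 1 - j)) =
  x k * oprod 1 k (fun j => x (k - j)).
Proof.
move=> ux [n|n]; first by rewrite -PoszD addn1 oprodI_natS.
have -> : Negz n + 1 = - n%:Z by rewrite NegzE -addn1 PoszD opprD subrK.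
rewrite NegzE !oprod_oppn big_nat_recl// oppr0 subr0 -NegzE mulVKr//.
apply: eq_bigr => i _; congr (x _)^-1.
by rewrite NegzE !intS; ring.
Qed.

Lemma oprodII_rec x : (forall n, x (Negz n) \is a GRing.unit) ->
  forall k, oprod 1 (k + 1) (fun j => x (j - 1)) =
  oprod 1 k (fun j => x (j - 1)) * x k.
Proof.
move=> ux [n|n]; first by rewrite -PoszD addn1 oprodII_natS.
have -> : Negz n + 1 = - n%:Z by rewrite NegzE -addn1 PoszD opprD subrK.
rewrite NegzE !oprod_oppn big_nat_recr//=.
have -> : - n%:Z - 1 = Negz n by rewrite NegzE -addn1 PoszD opprD.
by rewrite -NegzE mulrVK.
Qed.

End OrderedProducts.

Section Factors.
Context (K : numFieldType) (V : banachAlgType K).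
Implicit Types (A B Q : V).

Lemma qfactor1 A B Q k :
  qfactor [tuple A] [tuple B] Q k = (1 - B * Q ^ k)^-1 * (1 - A * Q ^ k).
Proof. by rewrite /qfactor big_ord1 !(tnth_nth 0). Qed.

Lemma qfactor_rev1 A B Q k :
  qfactor_rev [tuple A] [tuple B] Q k = (1 - A * Q ^ k) * (1 - B * Q ^ k)^-1.
Proof. by rewrite /qfactor_rev big_ord1 !(tnth_nth 0). Qed.

Lemma qfactor2 A1 A2 B1 B2 Q k :
  qfactor [tuple A1; A2] [tuple B1; B2] Q k =
  (1 - B1 * Q ^ k)^-1 * (1 - A1 * Q ^ k) *
  ((1 - B2 * Q ^ k)^-1 * (1 - A2 * Q ^ k)).
Proof. by rewrite /qfactor big_ord_recl big_ord1 !(tnth_nth 0). Qed.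

Lemma qfactI_natS r (A B : r.-tuple V) Q Z (n : nat) :
  qfactI A B Q Z n.+1%:Z = qfactor A B Q n * Z * qfactI A B Q Z n.
Proof. exact: (oprodI_natS (fun k => qfactor A B Q k * Z)). Qed.

Lemma qfactII_natS r (A B : r.-tuple V) Q Z (n : nat) :
  qfactII A B Q Z n.+1%:Z = qfactII A B Q Z n * (qfactor A B Q n * Z).
Proof. exact: (oprodII_natS (fun k => qfactor A B Q k * Z)). Qed.

Lemma qfactII_rev_natS r (A B : r.-tuple V) Q Z (n : nat) :
  qfactII_rev A B Q Z n.+1%:Z = Z * qfactor_rev A B Q n * qfactII_rev A B Q Z n.
Proof. exact: (oprodI_natS (fun k => Z * qfactor_rev A B Q k)). Qed.

End Factors.

(** * Passage to the opposite algebra *)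

Section Opposite.
Context (K : numFieldType) (V : banachAlgType K).

(** The carrier and its normed structure are kept, so limits and bilateral sums in the two algebras
    agree by conversion; only products have to be translated. *)
Definition opp_banach : banachAlgType K.
Proof.
apply: (@BanachAlg K (banach_base V) (1 : V) (fun x y : V => (y : V) * x)).
- by move=> x y z; rewrite mulrA.
- by move=> x; rewrite mulr1.
- by move=> x; rewrite mul1r.
- by move=> x y z; exact: (mulrDr (z : V)).
- by move=> x y z; exact: (mulrDl (y : V)).
- by move=> a x y; exact: (scalerAr a (y : V)).
- by move=> a x y; exact: (scalerAl a (y : V)).
- exact: oner_neq0.
- by move=> x y; rewrite mulrC; exact: ler_normM_banach.
Defined.

Implicit Types x y : V.

Lemma opp_mulE x y : (x : opp_banach) * y = (y * x : V).
Proof. by []. Qed.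

Lemma opp_unitE x : ((x : opp_banach) \is a GRing.unit) = (x \is a GRing.unit).
Proof.
by apply/unitrP/unitrP => -[y [yx xy]]; exists y; split; rewrite -?opp_mulE.
Qed.

Lemma opp_invE x : (x : opp_banach)^-1 = (x^-1 : V).
Proof.
have [ux|ux] := boolP (x \is a GRing.unit).
  have ux' : (x : opp_banach) \is a GRing.unit by rewrite opp_unitE.
  apply: (mulrI ux); rewrite mulrV//; exact: (mulVr ux').
by rewrite [RHS]invr_out// invr_out// opp_unitE.
Qed.

Lemma opp_expE x n : (x : opp_banach) ^+ n = (x ^+ n : V).
Proof. by elim: n => [//|n IH]; rewrite exprS exprSr -IH. Qed.

Lemma opp_exprzE x (k : int) : (x : opp_banach) ^ k = (x ^ k : V).
Proof. by case: k => n; [exact: opp_expE|rewrite /exprz opp_invE opp_expE]. Qed.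

End Opposite.

(** The mirror image of [psi_core2], with the three limits in reverse order. The work lies in moving
    [al] and the powers of [Q], which commute with [X] and [B], to the side where the opposite
    product puts them. *)
Lemma psi_core2_opp (R : realType) (V : banachAlgType R) (Q al X B : V)
    (f : int -> V) (P1 P2 P3 : nat -> V) :
  `|Q| < 1 -> Q \is a GRing.unit -> X \is a GRing.unit ->
  GRing.comm X Q -> GRing.comm B Q -> GRing.comm X al -> GRing.comm B al ->
  GRing.comm Q al -> (forall n : nat, 1 - B * Q ^+ n \is a GRing.unit) ->
  `|X * al| < 1 -> `|B * X^-1| < 1 ->
  (forall n : nat, 1 - al * Q ^+ n.+1 \is a GRing.unit) ->
  f 0 = 1 -> (forall k, f (k + 1) * (1 - B * Q ^ k) = f k * (X * (al - Q ^ k))) ->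
  P1 0%N = 1 -> (forall n, P1 n.+1 =
     (1 - al * B * Q ^+ n) * (1 - X * al * Q ^+ n)^-1 * P1 n) ->
  P2 0%N = 1 -> (forall n, P2 n.+1 = P2 n *
    ((1 - al * Q ^+ n.+1)^-1 * (1 - X * Q ^+ n) *
     ((1 - B * Q ^+ n)^-1 * (1 - Q ^+ n.+1)))) ->
  P3 0%N = 1 -> (forall n, P3 n.+1 =
    (1 - X^-1 * Q ^+ n.+1) * (1 - B * X^-1 * Q ^+ n)^-1 * P3 n) ->
  [/\ cvgn P1, cvgn P2, cvgn P3 & has_bsum f (limn P3 * limn P2 * limn P1)].
Proof.
move=> hQ1 uQ uX cXQ cBQ cXa cBa cQa uB hz hy ua f0 fS P10 P1S P20 P2S P30 P3S.
pose W := opp_banach V.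
have mW (x y : V) : (x : W) * y = (y * x : V) by [].
have vW (x : V) : (x : W)^-1 = (x^-1 : V) := opp_invE x.
have eW (x : V) n : (x : W) ^+ n = (x ^+ n : V) := opp_expE x n.
have zW (x : V) k : (x : W) ^ k = (x ^ k : V) := opp_exprzE x k.
have sW (x y : V) : (x : W) - y = (x - y : V) by [].
have oW : (1 : W) = (1 : V) by [].
have cn n : GRing.comm B (Q ^+ n) by exact: commrX.
have uBW n : (1 : W) - (B : W) * (Q : W) ^+ n \is a GRing.unit.
  by rewrite eW mW sW opp_unitE -cn.
have uaW n : (1 : W) - (al : W) * (Q : W) ^+ n.+1 \is a GRing.unit.
  rewrite eW mW sW opp_unitE (_ : Q ^+ n.+1 * al = al * Q ^+ n.+1)//.
  by apply/esym/commrX/commr_sym.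
have uQW : (Q : W) \is a GRing.unit by rewrite opp_unitE.
have uXW : (X : W) \is a GRing.unit by rewrite opp_unitE.
have hyW : `|(X : W)^-1 * (B : W)| < 1 by rewrite vW.
have fSW k : ((1 : W) - (B : W) * (Q : W) ^ k) * (f (k + 1) : W) =
    ((al : W) - (Q : W) ^ k) * (X : W) * (f k : W).
  by rewrite zW; have := fS k; rewrite (commrXz k cBQ).
have cXa' n : Q ^+ n * (X * al) = X * al * Q ^+ n.
  apply: commrM; apply/commr_sym/commrX => //; exact: commr_sym.
have cBa' n : Q ^+ n * (B * al) = B * al * Q ^+ n.
  apply: commrM; apply/commr_sym/commrX => //; exact: commr_sym.
have P1SW n : (P1 n.+1 : W) = (P1 n : W) *
    (((1 : W) - (al : W) * (X : W) * (Q : W) ^+ n)^-1 *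
     ((1 : W) - (al : W) * (B : W) * (Q : W) ^+ n)).
  rewrite eW vW; have := P1S n.
  by rewrite -cXa' -cBa -cBa'.
have caQ n : al * Q ^+ n = Q ^+ n * al by apply/commrX/commr_sym.
have cXQn n : X * Q ^+ n = Q ^+ n * X by exact: commrX.
have P2SW n : (P2 n.+1 : W) =
    ((1 : W) - (Q : W) ^+ n.+1) * ((1 : W) - (B : W) * (Q : W) ^+ n)^-1 *
    (((1 : W) - (X : W) * (Q : W) ^+ n) *
     ((1 : W) - (al : W) * (Q : W) ^+ n.+1)^-1) * (P2 n : W).
  by rewrite !eW !vW; have := P2S n; rewrite caQ cXQn cn.
have P3SW n : (P3 n.+1 : W) = (P3 n : W) *
    (((1 : W) - (X : W)^-1 * (B : W) * (Q : W) ^+ n)^-1 *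
     ((1 : W) - (X : W)^-1 * (Q : W) ^+ n.+1)).
  rewrite !eW !vW; have := P3S n.
  have cXVQ m : X^-1 * Q ^+ m = Q ^+ m * X^-1.
    by apply/commr_sym/commrV/commr_sym/commrX.
  have cBXV m : B * X^-1 * Q ^+ m = Q ^+ m * (B * X^-1).
    by apply/esym/commrM; [exact/commr_sym|exact/commr_sym/cXVQ].
  by rewrite cXVQ cBXV.
have [c1 c2 c3 hf] := @psi_core2 R W Q al X B hQ1 uQW uXW (commr_sym cXQ)
  (commr_sym cBQ) (commr_sym cXa) (commr_sym cBa) (commr_sym cQa) uBW hz hyW
  f P1 P2 P3 uaW f0 fSW P10 P1SW P20 P2SW P30 P3SW.
by split=> //; rewrite -mulrA.
Qed.

(** * The type I and type II summations *)

Section Summations.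
Context (R : realType) (V : banachAlgType R) (A B Z Q : V).
Context (hQ1 : `|Q| < 1) (hQA : GRing.comm Q A) (hQB : GRing.comm Q B).
Context (hQZ : GRing.comm Q Z) (hAB : GRing.comm A B) (hAZ : GRing.comm A Z).
Context (uQ : Q \is a GRing.unit) (uA : A \is a GRing.unit).
Context (uZ : Z \is a GRing.unit).
Context (uBQ : forall k : int, 1 - B * Q ^ k \is a GRing.unit).
Context (uAQ : forall k : int, k < 0 -> 1 - A * Q ^ k \is a GRing.unit).
Context (hZ1 : `|Z| < 1) (hBZA1 : `|B * Z^-1 * A^-1| < 1).

Let uAz : A * Z \is a GRing.unit. Proof. by rewrite unitrMl. Qed.

Let hAV (w : V) : GRing.comm A w -> GRing.comm w A^-1.
Proof. by move=> h; apply/commrV/commr_sym. Qed.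

Let hZV (w : V) : GRing.comm Z w -> GRing.comm w Z^-1.
Proof. by move=> h; apply/commrV/commr_sym. Qed.

Let cVZ : A^-1 * Z^-1 = Z^-1 * A^-1.
Proof. by apply/esym/hAV/commrV. Qed.

Let AZV : (A * Z)^-1 = Z^-1 * A^-1. Proof. by rewrite invrM. Qed.

Let uAV (n : nat) : 1 - A^-1 * Q ^+ n.+1 \is a GRing.unit.
Proof.
have uQn : Q ^+ n.+1 \is a GRing.unit by rewrite unitrX.
have -> : 1 - A^-1 * Q ^+ n.+1 = - (A^-1 * (1 - A * Q ^ Negz n) * Q ^+ n.+1).
  rewrite mulrBr mulr1 mulKr// mulrBl mulVr// opprB; congr (1 - _).
by rewrite unitrN !unitrMr ?unitrV// uAQ.
Qed.

Let uf (k : int) : k < 0 -> (1 - B * Q ^ k)^-1 * (1 - A * Q ^ k) * Z \is a GRing.unit.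
Proof. by move=> k0; rewrite !unitrMl ?unitrV// uAQ. Qed.

Lemma psi11_I_summation :
  let P1 := qfactII [tuple Q; Z * B * Z^-1 * A^-1]
                    [tuple A^-1 * Q; Z] Q 1 in
  let P2 := qfactI [tuple A * Z] [tuple Z * B * Z^-1] Q 1 in
  let P3 := qfactII [tuple Z^-1 * A^-1 * Q] [tuple B * Z^-1 * A^-1] Q 1 in
  [/\ bilateral_cvg (qfactI [tuple A] [tuple B] Q Z),
      cvg_infty P1, cvg_infty P2, cvg_infty P3 &
      psi11_I A B Q Z =
        Z^-1 * at_infty P1 * at_infty P2 * at_infty P3 * Z].
Proof.
move=> P1 P2 P3.
set T := qfactI [tuple A] [tuple B] Q Z.
have TS k : T (k + 1) = (1 - B * Q ^ k)^-1 * (1 - A * Q ^ k) * Z * T k.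
  rewrite -qfactor1.
  apply: (oprodI_rec (x := fun k => qfactor [tuple A] [tuple B] Q k * Z)).
  by move=> n; rewrite qfactor1 uf.
(* The terms satisfy the core recurrence with X = A Z even before conjugation, but with decay rate
   |(A Z)^-1 B|. Conjugation by [Z] replaces [B] by [C], and (A Z)^-1 C = B Z^-1 A^-1 is the element
   whose norm is bounded by hypothesis. *)
set C := Z * B * Z^-1.
have cQC : GRing.comm Q C by apply: commrM; [exact: commrM|exact: commrV].
have cAC : GRing.comm A C by apply: commrM; [exact: commrM|exact: commrV].
have cQAZ : GRing.comm Q (A * Z) by exact: commrM.
have cAAZ : GRing.comm A (A * Z) by exact: commrM.
have uC (n : nat) : 1 - C * Q ^+ n \is a GRing.unit.
  have -> : 1 - C * Q ^+ n = Z * (1 - B * Q ^ n%:Z) * Z^-1.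
    rewrite mulrBr mulr1 mulrBl mulrV// -!mulrA; congr (1 - Z * (B * _)).
    by apply/esym/hZV/commrX/commr_sym.
  by rewrite unitrMr ?unitrV// unitrMr.
have hz : `|A^-1 * (A * Z)| < 1 by rewrite mulKr.
have XC : (A * Z)^-1 * C = B * Z^-1 * A^-1.
  rewrite AZV -cVZ /C -!mulrA mulKr// [RHS]mulrA; apply/esym/hAV.
  by apply: commrM => //; exact: commrV.
have hy : `|(A * Z)^-1 * C| < 1 by rewrite XC.
have fS k : (1 - C * Q ^ k) * (Z * T (k + 1) * Z^-1) =
    (A^-1 - Q ^ k) * (A * Z) * (Z * T k * Z^-1).
  rewrite TS; have -> : (A^-1 - Q ^ k) * (A * Z) = (1 - A * Q ^ k) * Z.
    rewrite mulrA mulrBl mulVr//; congr ((1 - _) * _).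
    by apply/commr_sym/commrXz/commr_sym.
  have cZk : GRing.comm (1 - A * Q ^ k) Z.
    apply/commr_sym/commrB; first exact: commr1.
    by apply: commrM; [exact: commr_sym|apply/commrXz/commr_sym].
  have -> : Z * ((1 - B * Q ^ k)^-1 * (1 - A * Q ^ k) * Z * T k) * Z^-1 =
      Z * (1 - B * Q ^ k)^-1 * ((1 - A * Q ^ k) * Z * T k * Z^-1).
    by rewrite !mulrA.
  rewrite mulrA; have -> : (1 - C * Q ^ k) * (Z * (1 - B * Q ^ k)^-1) = Z.
    have -> : (1 - C * Q ^ k) = Z * (1 - B * Q ^ k) * Z^-1.
      rewrite mulrBr mulr1 mulrBl mulrV// -!mulrA; congr (1 - Z * (B * _)).
      by apply/esym/hZV/commrXz/commr_sym.
    by rewrite -!mulrA mulKr// mulrV// mulr1.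
  by rewrite !mulrA -cZk.
have f0 : Z * T 0 * Z^-1 = 1 by rewrite /T /qfactI oprod_nat big_geq// mulr1 mulrV.
have [c1 c2 c3 hf] : [/\ cvgn (fun n : nat => P1 n), cvgn (fun n : nat => P2 n),
    cvgn (fun n : nat => P3 n) & has_bsum (fun k => Z * T k * Z^-1)
    (at_infty P1 * at_infty P2 * at_infty P3)].
  apply: (psi_core hQ1 uQ uAz (commr_sym cQAZ) (commr_sym cQC)
    (hAV cAAZ) (hAV cAC) (hAV (commr_sym hQA)) uC hz hy uAV f0 fS).
  - by rewrite /P1 /qfactII oprod_nat big_geq.
  - move=> n; rewrite /P1 qfactII_natS qfactor2 mulr1 mulKr//.
    have -> : Z * B * Z^-1 * A^-1 = A^-1 * C by exact: hAV cAC.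
    by rewrite -[Q ^ n%:Z]/(Q ^+ n) -[A^-1 * Q * _]mulrA -!exprS.
  - by rewrite /P2 /qfactI oprod_nat big_geq.
  - by move=> n; rewrite /P2 qfactI_natS qfactor1 mulr1.
  - by rewrite /P3 /qfactII oprod_nat big_geq.
  - move=> n; rewrite /P3 qfactII_natS qfactor1 mulr1 XC AZV.
    by rewrite -[Q ^ n%:Z]/(Q ^+ n) -[_ * Q * _]mulrA -exprS.
have /has_bsumP[cT sT] : has_bsum T
    (Z^-1 * at_infty P1 * at_infty P2 * at_infty P3 * Z).
  have := has_bsumMr Z (has_bsumMl Z^-1 hf).
  rewrite [X in has_bsum X](_ : _ = T) ?mulrA//.
  by apply/funext => k; rewrite -!mulrA mulKr// mulVr// mulr1.
by [].
Qed.

Lemma psi11_II_summation :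
  let P1 := qfactII_rev [tuple Z^-1 * A^-1 * Q]
                        [tuple B * Z^-1 * A^-1] Q 1 in
  let P2 := qfactII [tuple A * Z; Q] [tuple A^-1 * Q; B] Q 1 in
  let P3 := qfactII_rev [tuple A^-1 * B] [tuple Z] Q 1 in
  [/\ bilateral_cvg (qfactII [tuple A] [tuple B] Q Z),
      cvg_infty P1, cvg_infty P2, cvg_infty P3 &
      psi11_II A B Q Z =
        Z^-1 * at_infty P1 * at_infty P2 * at_infty P3 * Z].
Proof.
move=> P1 P2 P3.
set S := qfactII [tuple A] [tuple B] Q Z.
have SS k : S (k + 1) = S k * ((1 - B * Q ^ k)^-1 * (1 - A * Q ^ k) * Z).
  rewrite -qfactor1.
  apply: (oprodII_rec (x := fun k => qfactor [tuple A] [tuple B] Q k * Z)).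
  by move=> n; rewrite qfactor1 uf.
have cQAZ : GRing.comm Q (A * Z) by exact: commrM.
have cAAZ : GRing.comm A (A * Z) by exact: commrM.
have XA : A * Z * A^-1 = Z by rewrite hAZ mulrK.
have hz : `|A * Z * A^-1| < 1 by rewrite XA.
have BX : B * (A * Z)^-1 = B * Z^-1 * A^-1 by rewrite AZV mulrA.
have hy : `|B * (A * Z)^-1| < 1 by rewrite BX.
have uBn (n : nat) : 1 - B * Q ^+ n \is a GRing.unit by exact: (uBQ n).
(* In each type II factor [Z] stands to the right of the inverse of 1 - B Q^k. Conjugation brings it
   to the left, and 1 - B Q^k then cancels after passing 1 - A Q^k, with which it commutes; [B]
   itself stays unconjugated. *)
have fS k : Z * S (k + 1) * Z^-1 * (1 - B * Q ^ k) =
    Z * S k * Z^-1 * (A * Z * (A^-1 - Q ^ k)).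
  have AQ : GRing.comm A (Q ^ k) by exact/commrXz/commr_sym.
  have -> : A * Z * (A^-1 - Q ^ k) = Z * (1 - A * Q ^ k).
    by rewrite hAZ -mulrA mulrBr mulrV.
  have cAB : (1 - A * Q ^ k) * (1 - B * Q ^ k) = (1 - B * Q ^ k) * (1 - A * Q ^ k).
    have BQ : GRing.comm B (Q ^ k) by exact/commrXz/commr_sym.
    apply: commrB; first exact: commr1.
    apply/commr_sym/commrB; first exact: commr1.
    apply: commrM; apply/commr_sym/commrM => //; exact: commr_sym.
  by rewrite SS !mulrA mulrK// -mulrA cAB mulrA !mulrVK.
have f0 : Z * S 0 * Z^-1 = 1 by rewrite /S /qfactII oprod_nat big_geq// mulr1 mulrV.
have [c1 c2 c3 hf] : [/\ cvgn (fun n : nat => P3 n), cvgn (fun n : nat => P2 n),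
    cvgn (fun n : nat => P1 n) & has_bsum (fun k => Z * S k * Z^-1)
    (at_infty P1 * at_infty P2 * at_infty P3)].
  apply: (psi_core2_opp hQ1 uQ uAz (commr_sym cQAZ) (commr_sym hQB)
    (hAV cAAZ) (hAV hAB) (hAV (commr_sym hQA)) uBn hz hy uAV f0 fS).
  - by rewrite /P3 /qfactII_rev oprod_nat big_geq.
  - by move=> n; rewrite /P3 qfactII_rev_natS qfactor_rev1 mul1r XA.
  - by rewrite /P2 /qfactII oprod_nat big_geq.
  - move=> n; rewrite /P2 qfactII_natS qfactor2 mulr1.
    by rewrite -[Q ^ n%:Z]/(Q ^+ n) -[A^-1 * Q * _]mulrA -!exprS.
  - by rewrite /P1 /qfactII_rev oprod_nat big_geq.
  - move=> n; rewrite /P1 qfactII_rev_natS qfactor_rev1 mul1r BX AZV.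
    by rewrite -[Q ^ n%:Z]/(Q ^+ n) -[_ * Q * _]mulrA -exprS.
have /has_bsumP[cS sS] : has_bsum S
    (Z^-1 * at_infty P1 * at_infty P2 * at_infty P3 * Z).
  have := has_bsumMr Z (has_bsumMl Z^-1 hf).
  rewrite [X in has_bsum X](_ : _ = S) ?mulrA//.
  by apply/funext => k; rewrite -!mulrA mulKr// mulVr// mulr1.
by [].
Qed.

End Summations.

Theorem theorem3p3 (R : realType) (V : banachAlgType R) (A B Z Q : V)
  (hQ1 : `|Q| < 1)
  (hQA : GRing.comm Q A) (hQB : GRing.comm Q B) (hQZ : GRing.comm Q Z)
  (hAB : GRing.comm A B) (hAZ : GRing.comm A Z)
  (uQ : Q \is a GRing.unit) (uA : A \is a GRing.unit)
  (uZ : Z \is a GRing.unit)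
  (uBQ : forall k : int, 1 - B * Q ^ k \is a GRing.unit)
  (uAQ : forall k : int, k < 0 -> 1 - A * Q ^ k \is a GRing.unit)
  (hZ1 : `|Z| < 1) (hBZA1 : `|B * Z^-1 * A^-1| < 1) :
  (let P1 := qfactII [tuple Q; Z * B * Z^-1 * A^-1]
                     [tuple A^-1 * Q; Z] Q 1 in
   let P2 := qfactI [tuple A * Z] [tuple Z * B * Z^-1] Q 1 in
   let P3 := qfactII [tuple Z^-1 * A^-1 * Q] [tuple B * Z^-1 * A^-1] Q 1 in
   [/\ bilateral_cvg (qfactI [tuple A] [tuple B] Q Z),
       cvg_infty P1, cvg_infty P2, cvg_infty P3 &
       psi11_I A B Q Z =
         Z^-1 * at_infty P1 * at_infty P2 * at_infty P3 * Z]) /\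
  (let P1 := qfactII_rev [tuple Z^-1 * A^-1 * Q]
                         [tuple B * Z^-1 * A^-1] Q 1 in
   let P2 := qfactII [tuple A * Z; Q] [tuple A^-1 * Q; B] Q 1 in
   let P3 := qfactII_rev [tuple A^-1 * B] [tuple Z] Q 1 in
   [/\ bilateral_cvg (qfactII [tuple A] [tuple B] Q Z),
       cvg_infty P1, cvg_infty P2, cvg_infty P3 &
       psi11_II A B Q Z =
         Z^-1 * at_infty P1 * at_infty P2 * at_infty P3 * Z]).
Proof.
by split; [exact: psi11_I_summation|exact: psi11_II_summation].
Qed.
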